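(* Let $\Delta\ge0$ and let $\mathbf w=\{w_n\}_{n=1}^\infty$ be a sequence of positive numbers. Suppose that for each $\sigma>\Delta$ there exists $C_\sigma>0$ such that $w_n^{-1}n^{-2\sigma}\le C_\sigma$ for each $n\ge1$, and let $\varphi$ be a multiplier of $\mathcal H^{\mathbf w}$. Then $\sum_{n=1}^\infty w_n^{-1}n^{-2\sigma'}<\infty$ whenever $\sigma'>\Delta+\frac12$; for each positive integer $N$, $\sum_{n\in\langle P_N\rangle}w_n^{-1}n^{-2\sigma}<\infty$ whenever $\sigma>\Delta$; and $|\varphi|_{\Omega_\Delta}\le\|M_\varphi\|$.
   Context: For real $\delta$, $\Omega_\delta=\{z\in\mathbb C:\mathrm{Re}(z)>\delta\}$. $P_N$ is the set of the first $N$ primes $p_1<\dots<p_N$, and $\langle P_N\rangle=\{p_1^{\alpha_1}\cdots p_N^{\alpha_N}:\alpha_j\in\{0,1,2,\dots\}\}$. $\mathcal H^{\mathbf w}=\{\sum_{n=1}^\infty a_nn^{-s}:\sum_{n=1}^\infty|a_n|^2w_n<\infty\}$ is the Hilbert space of Dirichlet series with inner product $\langle\sum a_nn^{-s},\sum b_nn^{-s}\rangle_{\mathbf w}=\sum a_n\overline{b_n}w_n$. If $\sigma_0>0$ is such that $\sum_{n=1}^\infty w_n^{-1}n^{-2\sigma}<\infty$ for all $\sigma>\sigma_0$ (here $\sigma_0=\Delta+\frac12$ may be used), its elements converge absolutely in $\Omega_{\sigma_0}$ and are regarded as functions there. A multiplier of $\mathcal H^{\mathbf w}$ is a function $\varphi$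 with domain containing $\Omega_{\sigma_0}$ such that $\varphi f\in\mathcal H^{\mathbf w}$ for every $f\in\mathcal H^{\mathbf w}$ (equality of functions on $\Omega_{\sigma_0}$). Then $\varphi$ itself is (on $\Omega_{\sigma_0}$) an element of $\mathcal H^{\mathbf w}$, and $\varphi$ is identified with its Dirichlet series. $M_\varphi f=\varphi f$ is a bounded operator on $\mathcal H^{\mathbf w}$ and $\|M_\varphi\|$ is its operator norm. $|\varphi|_{\Omega_\sigma}$ denotes $\sup_{s\in\Omega_\sigma}|\varphi(s)|$, where $\varphi$ is understood as analytically continued to $\Omega_\sigma$; it is $+\infty$ if $\varphi$ is unbounded on $\Omega_\sigma$ or has no analytic continuation to $\Omega_\sigma$. *)

(* Defs.v *)
(* Stdlib reals and Coquelicot; MathComp's [boot] only for natural-number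
   arithmetic ([prime], [\prod]). *)
From Stdlib Require Import Reals ClassicalEpsilon.
From Coquelicot Require Import Coquelicot.
From mathcomp Require Import ssreflect ssrfun ssrbool eqtype ssrnat seq.
From mathcomp Require Import fintype bigop prime.

Set Implicit Arguments.
Unset Strict Implicit.
Unset Printing Implicit Defensive.

Local Open Scope R_scope.

(** Primes *)

Lemma ex_prime_gt (m : nat) : exists p, (m < p)%N && prime p.
Proof. by case: (prime_above m) => p lt_mp pr_p; exists p; rewrite lt_mp. Qed.

Definition next_prime (m : nat) : nat := ex_minn (ex_prime_gt m).

(* Indexed from 0: [nth_prime 0 = 2], [nth_prime 1 = 3], etc *)
Definition nth_prime (j : nat) : nat := iter j next_prime 2%N.

Definition prime_span (N n : nat) : Prop :=
  exists alpha : nat -> nat, n = (\prod_(j < N) nth_prime j ^ alpha j)%N.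

(** Dirichlet series.  All sequences [nat -> _] below are indexed by the
    integers n >= 1; their value at 0 is never used. *)

Definition restrict (P : nat -> Prop) (u : nat -> R) (n : nat) : R :=
  if excluded_middle_informative (P n) then u n else 0.

Definition summable (u : nat -> R) : Prop := ex_series (fun k => u (S k)).

Definition half_plane (delta : R) (s : C) : Prop := delta < Re s.

Definition Cexp (z : C) : C :=
  (exp (Re z) * cos (Im z), exp (Re z) * sin (Im z)).

(* n^{-s} *)
Definition Dmono (n : nat) (s : C) : C :=
  Cexp (Copp (Cmult s (RtoC (ln (INR n))))).

Definition is_Dsum (a : nat -> C) (s l : C) : Prop :=
  is_series (fun k => Cmult (a (S k)) (Dmono (S k) s)) l.

(** The space H^w, as a space of functions on [half_plane sigma0] *)

Definition wl2 (w : nat -> R) (a : nat -> C) : Prop :=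
  summable (fun n => Cmod (a n) ^ 2 * w n).

Definition wnorm (w : nat -> R) (a : nat -> C) : R :=
  sqrt (Series (fun k => Cmod (a (S k)) ^ 2 * w (S k))).

(* f is the function on [half_plane sigma0] given by the element of H^w with
   coefficients a *)
Definition Hw_repr (w : nat -> R) (sigma0 : R) (a : nat -> C) (f : C -> C)
  : Prop :=
  wl2 w a /\ (forall s, half_plane sigma0 s -> is_Dsum a s (f s)).

Definition in_Hw (w : nat -> R) (sigma0 : R) (f : C -> C) : Prop :=
  exists a, Hw_repr w sigma0 a f.

(* Functions are total, but only their values on [half_plane sigma0] matter. *)
Definition multiplier (w : nat -> R) (sigma0 : R) (phi : C -> C) : Prop :=
  forall f, in_Hw w sigma0 f -> in_Hw w sigma0 (fun s => Cmult (phi s) (f s)).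

(* Operator norm of f |-> phi f: supremum of the norm of phi f over the unit
   ball, where a and b are the coefficients of f and phi f *)
Definition mult_norm (w : nat -> R) (sigma0 : R) (phi : C -> C) : Rbar :=
  Lub_Rbar (fun x => exists (f : C -> C) (a b : nat -> C),
    Hw_repr w sigma0 a f /\ wnorm w a <= 1 /\
    Hw_repr w sigma0 b (fun s => Cmult (phi s) (f s)) /\ x = wnorm w b).

(** Analytic continuation and supremum norm *)

Definition is_continuation (phi : C -> C) (sigma0 sigma : R) (g : C -> C)
  : Prop :=
  (forall s : C, half_plane sigma s -> ex_derive g s) /\
  (forall s : C, half_plane sigma0 s -> g s = phi s).

(* For sigma <= sigma0, a continuation g is unique on [half_plane sigma], so
   this is the supremum of |g| there; it is the infimum of the empty set,
   [p_infty], if g is unbounded or does not exist. *)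
Definition sup_norm (phi : C -> C) (sigma0 sigma : R) : Rbar :=
  Glb_Rbar (fun M => exists g, is_continuation phi sigma0 sigma g /\
    forall s, half_plane sigma s -> Cmod (g s) <= M).

(* Main.v *)
(** Test the multiplier on truncations of the reproducing kernel at s of the
    subspace of H^w spanned by the n^{-s} with n in <P_N>.  Because <P_N> is
    multiplicatively closed and closed under divisors, the <P_N>-part of phi f
    is phi_N f for f in this subspace, phi_N being the <P_N>-part of phi; the
    kernel at s exists for every s in Omega_Delta by the Euler product, and so
    |phi_N(s)| <= ||M_phi|| there.

    Truncating phi_N gives Dirichlet polynomials Q_N that are almost bounded by
    ||M_phi|| on Omega_Delta and converge to phi, with all Taylor coefficients,
    far to the right.  Cauchy's estimates, obtained by averaging over roots of
    unity, carry the convergence over to Omega_Delta and make the limit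
    holomorphic. *)
Require Import Defs.
From Stdlib Require Import Reals Factorial Lra ClassicalEpsilon.
From Coquelicot Require Import Coquelicot.
From HB Require Import structures.
From mathcomp Require Import ssreflect ssrfun ssrbool eqtype ssrnat seq.
From mathcomp Require Import fintype bigop prime div.
Local Open Scope R_scope.

(** In the strip [Delta < Re s <= Delta + 1/2] the hypotheses control neither the kernel of the
    whole space nor the series of [phi]; only the parts supported on [<P_N>] are known to converge
    there, with sums that depend on [N]. What survives uniformly in [N] is the bound by the
    multiplier norm, so the limit has to be reached from the right by a normal-family argument.
    Dirichlet polynomials serve because they are entire, with explicit Taylor remainders on discs of
    every radius: a disc centred right of [Delta + 1/2] can reach deep into the strip. Truncating
    the kernel at [X] makes the test function a Dirichlet polynomial, so its product with [phi] is a
    finite combination of dilated copies of the series of [phi]. With [E_X] and [E] the truncated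
    and full kernel sums at [s], the test gives [E_X |phi_N(s)| <= M sqrt(E_X) sqrt(E)]. The loss
    [sqrt(E / E_X)] tends to 1, which is why the constant is exactly [M]. *)

Lemma Rplus_assoc' : associative Rplus.
Proof. by move=> x y z; rewrite Rplus_assoc. Qed.
Lemma Rplus_comm' : commutative Rplus.
Proof. exact: Rplus_comm. Qed.
Lemma Rplus_0_l' : left_id 0 Rplus.
Proof. exact: Rplus_0_l. Qed.
HB.instance Definition _ :=
  Monoid.isComLaw.Build R 0 Rplus Rplus_assoc' Rplus_comm' Rplus_0_l'.

Lemma Cplus_assoc' : associative Cplus.
Proof. exact: Cplus_assoc. Qed.
Lemma Cplus_comm' : commutative Cplus.
Proof. exact: Cplus_comm. Qed.
Lemma Cplus_0_l' : left_id (RtoC 0) Cplus.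
Proof. exact: Cplus_0_l. Qed.
HB.instance Definition _ :=
  Monoid.isComLaw.Build C (RtoC 0) Cplus Cplus_assoc' Cplus_comm' Cplus_0_l'.

Reserved Notation "\rsum_ ( m <= i < n ) F"
  (at level 41, F at level 41, i, m, n at level 50).
Reserved Notation "\csum_ ( m <= i < n ) F"
  (at level 41, F at level 41, i, m, n at level 50).
Notation "\rsum_ ( m <= i < n ) F" :=
  (\big[Rplus/0%R]_(m%N <= i < n%N) F%R) : R_scope.
Notation "\csum_ ( m <= i < n ) F" :=
  (\big[Cplus/RtoC 0]_(m%N <= i < n%N) F%C) : R_scope.
Notation "\csum_ ( m <= i < n ) F" :=
  (\big[Cplus/RtoC 0]_(m%N <= i < n%N) F%C) : C_scope.

(** * Finite sums *)

Lemma Cmod_csum m n (F : nat -> C) :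
  Cmod (\csum_(m <= i < n) F i) <= \rsum_(m <= i < n) Cmod (F i).
Proof.
elim/big_ind2: _ => [|x a y b Hx Hy|i _]; rewrite ?Cmod_0; try lra.
have := Cmod_triangle a b; lra.
Qed.

Lemma rsum_le m n (F G : nat -> R) :
  (forall i, (m <= i < n)%N -> F i <= G i) ->
  \rsum_(m <= i < n) F i <= \rsum_(m <= i < n) G i.
Proof.
move=> H; rewrite big_nat_cond [X in _ <= X]big_nat_cond.
elim/big_ind2: _ => [|x a y b Hx Hy|i]; try lra.
by rewrite andbT => /H.
Qed.

Lemma rsum_ge0 m n (F : nat -> R) :
  (forall i, (m <= i < n)%N -> 0 <= F i) -> 0 <= \rsum_(m <= i < n) F i.
Proof.
move=> H; rewrite big_nat_cond.
elim/big_ind: _ => [|x y Hx Hy|i]; try lra.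
by rewrite andbT => /H.
Qed.

Lemma rsum_scal m n (c : R) (F : nat -> R) :
  \rsum_(m <= i < n) (c * F i) = c * \rsum_(m <= i < n) F i.
Proof.
symmetry; apply: (big_morph (fun x => c * x)) => [x y|]; ring.
Qed.

Lemma csum_scal m n (c : C) (F : nat -> C) :
  \csum_(m <= i < n) (c * F i) = (c * \csum_(m <= i < n) F i)%C.
Proof.
symmetry; apply: (big_morph (fun x => c * x)%C) => [x y|]; ring.
Qed.

Lemma RtoC_rsum m n (F : nat -> R) :
  RtoC (\rsum_(m <= i < n) F i) = \csum_(m <= i < n) (RtoC (F i)).
Proof. apply: (big_morph RtoC) => [x y|//]; exact: RtoC_plus. Qed.

Lemma rsum_mono_r m n p (F : nat -> R) :
  (m <= n)%N -> (n <= p)%N ->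
  (forall i, (m <= i)%N -> 0 <= F i) ->
  \rsum_(m <= i < n) F i <= \rsum_(m <= i < p) F i.
Proof.
move=> mn np F0; rewrite (big_cat_nat mn np) /=.
have := @rsum_ge0 n p F; suff H : forall i, (n <= i < p)%N -> 0 <= F i.
  by move=> /(_ H); lra.
by move=> i /andP[ni _]; apply: F0; apply: leq_trans ni.
Qed.

Lemma rsum_term_le m n j (F : nat -> R) :
  (m <= j < n)%N -> (forall i, (m <= i)%N -> 0 <= F i) ->
  F j <= \rsum_(m <= i < n) F i.
Proof.
move=> /andP[mj jn] F0.
apply: Rle_trans (rsum_mono_r _ _ _ _ (leqW mj) jn F0).
rewrite big_nat_recr //=.
have := @rsum_ge0 m j F; suff H : forall i, (m <= i < j)%N -> 0 <= F i.
  by move=> /(_ H); lra.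
by move=> i /andP[mi _]; apply: F0.
Qed.

(** The quadratic [A + 2 t S + t^2 B] is a sum of squares, hence nonnegative for every [t];
    [t = - S / B] gives the inequality. *)
Lemma rsum_cauchy_schwarz m n (x y : nat -> R) :
  (\rsum_(m <= i < n) (x i * y i)) ^ 2
  <= (\rsum_(m <= i < n) x i ^ 2) * \rsum_(m <= i < n) y i ^ 2.
Proof.
set A := \rsum_(m <= i < n) x i ^ 2; set B := \rsum_(m <= i < n) y i ^ 2.
set S := \rsum_(m <= i < n) (x i * y i).
have Q t : 0 <= A + 2 * t * S + t * t * B.
  rewrite /A /B /S -!rsum_scal -!big_split /=.
  apply: rsum_ge0 => i _.
  have := pow2_ge_0 (x i + t * y i); lra.
have B0 : 0 <= B by apply: rsum_ge0 => i _; apply: pow2_ge_0.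
have A0 : 0 <= A by apply: rsum_ge0 => i _; apply: pow2_ge_0.
case: (Req_dec B 0) => [B_0|B_n].
  case: (Req_dec S 0) => [->|Sn]; first by rewrite B_0; lra.
  (* With [B = 0] the quadratic is affine in [t]; this [t] makes it equal to -1, which is absurd. *)
  have := Q (- (A + 1) / (2 * S)).
  rewrite B_0; have -> : A + 2 * (- (A + 1) / (2 * S)) * S
    + - (A + 1) / (2 * S) * (- (A + 1) / (2 * S)) * 0 = -1 by field.
  lra.
have := Q (- S / B).
have -> : A + 2 * (- S / B) * S + - S / B * (- S / B) * B
  = (A * B - S ^ 2) / B by field.
move=> H; suff : 0 <= A * B - S ^ 2 by lra.
have := Rmult_le_compat_r _ _ _ B0 H.
have -> : (A * B - S ^ 2) / B * B = A * B - S ^ 2 by field.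
lra.
Qed.

(** * Limits in C *)

Definition Clim (u : nat -> C) (l : C) : Prop :=
  is_lim_seq (fun n => Cmod (u n - l)) 0.

Lemma Clim_eps (u : nat -> C) (l : C) :
  Clim u l <->
  (forall eps, 0 < eps -> exists N, forall n, (N <= n)%N ->
     Cmod (u n - l) < eps).
Proof.
split.
- move=> /is_lim_seq_spec H eps e0.
  have [N HN] := H (mkposreal eps e0); exists N => n /leP Nn.
  have := HN n Nn; rewrite /= Rminus_0_r => h.
  exact: Rle_lt_trans (Rle_abs _) h.
- move=> H; apply/is_lim_seq_spec => eps.
  have [N HN] := H eps (cond_pos eps); exists N => n /leP Nn.
  rewrite /= Rminus_0_r Rabs_pos_eq; first exact: HN.
  exact: Cmod_ge_0.
Qed.

Lemma Clim_filterlim (u : nat -> C) (l : C) :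
  Clim u l <-> filterlim u eventually (locally l).
Proof.
have spec := filterlim_locally_ball_norm (K := C_AbsRing) (U := C_NormedModule)
  (F := eventually) (FF := filter_filter) u l.
have E (x : C) : @norm C_AbsRing C_NormedModule (minus x l) = Cmod (x - l).
  by [].
rewrite Clim_eps; split.
- move=> H; apply/spec => eps.
  have [N HN] := H eps (cond_pos eps); exists N => n /leP Nn.
  by rewrite /ball_norm E; apply: HN.
- move=> /spec H eps e0.
  have [N HN] := H (mkposreal eps e0).
  exists N => n /leP Nn.
  by have := HN n Nn; rewrite /ball_norm E.
Qed.

Lemma Clim_ext u v l : (forall n, u n = v n) -> Clim u l -> Clim v l.
Proof. by move=> H; apply: is_lim_seq_ext => n; rewrite H. Qed.

Lemma Clim_const l : Clim (fun _ => l) l.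
Proof.
apply: (is_lim_seq_ext (fun _ => 0)); last exact: is_lim_seq_const.
by move=> n; rewrite (_ : l - l = 0)%C ?Cmod_0 //; ring.
Qed.

Lemma Clim_Cmod_bound u l (b : nat -> R) :
  is_lim_seq b 0 -> (forall n, Cmod (u n - l) <= b n) -> Clim u l.
Proof.
move=> Hb H; apply: is_lim_seq_le_le (is_lim_seq_const 0) Hb => n.
by split; [exact: Cmod_ge_0|].
Qed.

Lemma Clim_plus u v l k :
  Clim u l -> Clim v k -> Clim (fun n => u n + v n)%C (l + k)%C.
Proof.
move=> Hu Hv.
apply: (Clim_Cmod_bound _ _ (fun n => Cmod (u n - l) + Cmod (v n - k))).
  by rewrite -(Rplus_0_l 0); apply: is_lim_seq_plus' Hu Hv.
move=> n; rewrite (_ : u n + v n - (l + k) = (u n - l) + (v n - k))%C.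
  exact: Cmod_triangle.
ring.
Qed.

Lemma Clim_scal c u l : Clim u l -> Clim (fun n => c * u n)%C (c * l)%C.
Proof.
move=> Hu; apply: (Clim_Cmod_bound _ _ (fun n => Cmod c * Cmod (u n - l))).
  by rewrite -(Rmult_0_r (Cmod c)); apply: is_lim_seq_scal_l Hu.
move=> n; rewrite -Cmod_mult; right; congr Cmod; ring.
Qed.

Lemma Clim_minus u v l k :
  Clim u l -> Clim v k -> Clim (fun n => u n - v n)%C (l - k)%C.
Proof.
move=> Hu Hv; have := Clim_plus _ _ _ _ Hu (Clim_scal (RtoC (-1)) _ _ Hv).
rewrite (_ : (l + (-1)%R * k = l - k)%C); last by ring.
by apply: Clim_ext => n; ring.
Qed.

Lemma Clim_unique u l k : Clim u l -> Clim u k -> l = k.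
Proof.
move=> Hl Hk; have := Clim_minus _ _ _ _ Hl Hk.
move=> /(is_lim_seq_ext _ (fun _ => Cmod (k - l))) H.
have {}H : is_lim_seq (fun _ => Cmod (k - l)) 0.
  by apply: H => n; congr Cmod; ring.
have := is_lim_seq_unique _ _ H; rewrite Lim_seq_const => -[] /Cmod_eq_0 E.
by transitivity (k - (k - l))%C; [ring | rewrite E; ring].
Qed.

Lemma Clim_Cmod u l : Clim u l -> is_lim_seq (fun n => Cmod (u n)) (Cmod l).
Proof.
move=> Hu.
apply: (is_lim_seq_le_le (fun n => Cmod l - Cmod (u n - l)) _
  (fun n => Cmod l + Cmod (u n - l))).
- move=> n.
  have := Cmod_triangle l (u n - l); rewrite (_ : l + (u n - l) = u n)%C; last by ring.
  have := Cmod_triangle (u n) (- (u n - l)); rewrite Cmod_opp.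
  rewrite (_ : u n + - (u n - l) = l)%C; last by ring.
  lra.
- rewrite -{2}(Rminus_0_r (Cmod l)).
  by apply: is_lim_seq_minus' Hu; apply: is_lim_seq_const.
- rewrite -{2}(Rplus_0_r (Cmod l)).
  by apply: is_lim_seq_plus' Hu; apply: is_lim_seq_const.
Qed.

Lemma Clim_Cmod_le u l B N :
  Clim u l -> (forall n, (N <= n)%N -> Cmod (u n) <= B) -> Cmod l <= B.
Proof.
move=> /Clim_Cmod Hu H.
apply: (is_lim_seq_le_loc _ _ (Cmod l) B _ Hu (is_lim_seq_const B)).
by exists N => n /leP /H.
Qed.

Lemma Clim_subseq u l (f : nat -> nat) :
  (forall A, exists B, forall n, (B <= n)%N -> (A <= f n)%N) ->
  Clim u l -> Clim (fun n => u (f n)) l.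
Proof.
move=> Hf /Clim_eps H; apply/Clim_eps => eps e0; have [A HA] := H eps e0.
by have [B HB] := Hf A; exists B => n Bn; apply: HA; apply: HB.
Qed.

Lemma Clim_bounded u l : Clim u l -> exists B, forall n, Cmod (u n) <= B.
Proof.
move=> /Clim_Cmod /is_lim_seq_Reals Hu.
have [B [_ HB]] := maj_by_pos _ (exist _ _ Hu).
by exists B => n; have := HB n; rewrite Rabs_pos_eq //; apply: Cmod_ge_0.
Qed.

Lemma Clim_cauchy u :
  (forall eps, 0 < eps -> exists N, forall m n, (N <= m)%N -> (N <= n)%N ->
     Cmod (u m - u n) <= eps) ->
  exists l, Clim u l.
Proof.
move=> H.
suff [l Hl] : exists l, filterlim u eventually (locally (l : C_CompleteNormedModule)).
  by exists l; apply/Clim_filterlim.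
apply/(Hierarchy.filterlim_locally_cauchy (U := C_CompleteNormedModule)) => eps.
have e2 : 0 < eps / 2 by have := cond_pos eps; lra.
have [N HN] := H _ e2; exists (fun n => (N <= n)%coq_nat); split.
  by exists N.
move=> m n /leP Hm /leP Hn.
apply: (norm_compat1 (V := C_NormedModule)).
have := HN n m Hn Hm; have := cond_pos eps.
by change (norm _) with (Cmod (u n - u m)); lra.
Qed.

Lemma is_series_Clim (u : nat -> C) (l : C) :
  is_series (fun k => u (S k)) l <-> Clim (fun N => \csum_(1 <= n < N.+1) u n) l.
Proof.
have E n : sum_n (fun k => u k.+1) n = \csum_(1 <= i < n.+2) u i.
  elim: n => [|n IH]; first by rewrite sum_O big_nat1.
  by rewrite sum_Sn IH [in RHS]big_nat_recr.
rewrite /is_series -Clim_filterlim !Clim_eps; split=> H eps /H [N HN].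
- exists N.+1 => -[|n] // Nn; rewrite -E; exact: HN.
- by exists N => n Nn; rewrite E; apply: HN; apply: leqW.
Qed.

Lemma is_series_rsum (u : nat -> R) (l : R) :
  is_series (fun k => u (S k)) l
  <-> is_lim_seq (fun N => \rsum_(1 <= n < N.+1) u n) l.
Proof.
have E n : sum_n (fun k => u k.+1) n = \rsum_(1 <= i < n.+2) u i.
  elim: n => [|n IH]; first by rewrite sum_O big_nat1.
  by rewrite sum_Sn IH [in RHS]big_nat_recr.
rewrite /is_series (is_lim_seq_incr_1 (fun N => \rsum_(1 <= n < N.+1) u n)).
change (is_lim_seq (sum_n (fun k => u k.+1)) l
  <-> is_lim_seq (fun N => \rsum_(1 <= n < N.+2) u n) l).
by split; apply: is_lim_seq_ext => n; rewrite E.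
Qed.

(** Summability of a nonnegative sequence without mention of its limit; in this form domination,
    scaling and addition are inequalities between finite sums. *)
Definition bounded_sums (u : nat -> R) : Prop :=
  (forall n, (0 < n)%N -> 0 <= u n) /\
  exists B, forall N, \rsum_(1 <= n < N.+1) u n <= B.

Lemma bounded_sums_summable u : bounded_sums u -> summable u.
Proof.
move=> [u0 [B HB]].
have [l Hl] : ex_finite_lim_seq (fun N => \rsum_(1 <= n < N.+1) u n).
  apply: (ex_finite_lim_seq_incr _ B) => // n.
  apply: rsum_mono_r => // i; exact: u0.
by exists l; apply/is_series_rsum.
Qed.

Lemma rsum_le_Series u N :
  (forall n, (0 < n)%N -> 0 <= u n) -> summable u ->
  \rsum_(1 <= n < N.+1) u n <= Series (fun k => u (S k)).
Proof.
move=> u0 /Series_correct /is_series_rsum H.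
apply: (is_lim_seq_incr_compare _ _ H _ N) => n.
apply: rsum_mono_r => // i; exact: u0.
Qed.

Lemma summable_bounded_sums u :
  (forall n, (0 < n)%N -> 0 <= u n) -> summable u -> bounded_sums u.
Proof.
move=> u0 Hu; split=> //; exists (Series (fun k => u (S k))) => N.
exact: rsum_le_Series.
Qed.

Lemma bounded_sums_le u v :
  (forall n, (0 < n)%N -> 0 <= u n <= v n) -> bounded_sums v -> bounded_sums u.
Proof.
move=> H [v0 [B HB]]; split; first by move=> n /H [].
exists B => N; apply: Rle_trans (HB N).
by apply: rsum_le => i /andP[/H []].
Qed.

Lemma bounded_sums_scal c u :
  0 <= c -> bounded_sums u -> bounded_sums (fun n => c * u n).
Proof.
move=> c0 [u0 [B HB]]; split; first by move=> n /u0; apply: Rmult_le_pos.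
by exists (c * B) => N; rewrite rsum_scal; apply: Rmult_le_compat_l.
Qed.

(** The bound does not involve the upper end [y], so it controls both finite blocks and the distance
    of a partial sum from its limit. *)
Lemma bounded_sums_tail u :
  bounded_sums u -> forall eps, 0 < eps -> exists X, forall x y,
    (X < x)%N -> \rsum_(x <= n < y) u n <= eps.
Proof.
move=> Hu eps e0; have [u0 _] := Hu.
have := bounded_sums_summable _ Hu => -[l /is_series_rsum Hl].
have Hle N : \rsum_(1 <= n < N.+1) u n <= l.
  apply: (is_lim_seq_incr_compare _ _ Hl) => n.
  apply: rsum_mono_r => // i; exact: u0.
have /is_lim_seq_spec /(_ (mkposreal eps e0)) [X HX] := Hl.
exists X => x y Xx.
case: (leqP x y) => [xy|yx]; last first.
  by rewrite big_geq; [lra | exact: ltnW].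
case: x Xx xy => // x Xx xy; case: y xy => // y xy.
have := Hle y; rewrite (big_cat_nat (n := x.+1)) //=.
have := HX x (elimT (@leP X x) Xx); move=> /= /Rabs_def2; lra.
Qed.

Lemma abs_conv (u : nat -> C) :
  bounded_sums (fun n => Cmod (u n)) ->
  exists l, Clim (fun N => \csum_(1 <= n < N.+1) u n) l.
Proof.
move=> Hu; apply: Clim_cauchy => eps e0.
have [X HX] := bounded_sums_tail _ Hu _ e0; exists X.
suff H m n : (X <= m)%N -> (m <= n)%N ->
    Cmod (\csum_(1 <= i < n.+1) u i - \csum_(1 <= i < m.+1) u i) <= eps.
  move=> m n Xm Xn; case: (leqP m n) => mn; last by apply: H => //; apply: ltnW.
  by rewrite -Cmod_opp Copp_minus_distr; apply: H.
move=> Xm mn; rewrite (@big_cat_nat _ _ _ m.+1) //=.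
rewrite (_ : forall a b, a + b - a = b)%C; last by move=> a b; ring.
by apply: Rle_trans (Cmod_csum _ _ _) _; apply: HX.
Qed.

Lemma csum_Clim_tail (u : nat -> C) l N eps :
  Clim (fun N => \csum_(1 <= n < N.+1) u n) l ->
  (forall y, \rsum_(N.+1 <= n < y) Cmod (u n) <= eps) ->
  Cmod (l - \csum_(1 <= n < N.+1) u n) <= eps.
Proof.
move=> Hu H; have := Clim_minus _ _ _ _ Hu (Clim_const (\csum_(1 <= n < N.+1) u n)).
move=> /(Clim_Cmod_le _ _ eps N); apply=> n Nn.
rewrite (@big_cat_nat _ _ _ N.+1) //=.
rewrite (_ : forall a b, a + b - a = b)%C; last by move=> a b; ring.
exact: Rle_trans (Cmod_csum _ _ _) (H _).
Qed.

(** Dominated convergence for series in the case where each term is eventually stationary: the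
    dominating series makes everything beyond some [Y] small uniformly in [N], and the first [Y]
    terms agree exactly for large [N]. It applies to smooth parts because a fixed [n] is [N]-smooth
    as soon as [N] is large. *)
Lemma tannery (v : nat -> nat -> C) (u : nat -> C) (d : nat -> R) (X : nat -> nat) l :
  bounded_sums d ->
  (forall N n, (0 < n)%N -> Cmod (v N n) <= d n) ->
  (forall n, (0 < n)%N -> Cmod (u n) <= d n) ->
  (forall n, (0 < n)%N -> exists N0, forall N, (N0 <= N)%N -> v N n = u n) ->
  (forall N, (N <= X N)%N) ->
  Clim (fun N => \csum_(1 <= n < N.+1) u n) l ->
  Clim (fun N => \csum_(1 <= n < (X N).+1) v N n) l.
Proof.
move=> Hd Hv Hu Hconst HX Hl; apply/Clim_eps => eps e0.
have e4 : 0 < eps / 4 by lra.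
have [Y HY] := bounded_sums_tail _ Hd _ e4.
have [N0 HN0] : exists N0, forall N n, (N0 <= N)%N -> (1 <= n < Y.+1)%N -> v N n = u n.
  elim: {HY}Y => [|Y [N0 HN]]; first by exists 0%N => N n _; case: n.
  have [N1 HN1] := Hconst Y.+1 isT; exists (maxn N0 N1) => N n.
  rewrite geq_max => /andP[H0 H1] /andP[n0]; rewrite ltnS leq_eqVlt => /orP[/eqP->|nY].
    exact: HN1.
  by apply: HN => //; rewrite n0.
exists (maxn N0 Y) => N; rewrite geq_max => /andP[NN0 NY].
have YX : (Y <= X N)%N by apply: leq_trans (HX N).
rewrite (@big_cat_nat _ _ _ Y.+1) //= (eq_big_nat _ _ (HN0 N ^~ NN0)).
set A := \csum_(1 <= i < Y.+1) u i; set T := \csum_(_ <= i < _) _.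
have H1 : Cmod T <= eps / 4.
  apply: Rle_trans (Cmod_csum _ _ _) _; apply: Rle_trans (HY Y.+1 (X N).+1 _) => //.
  by apply: rsum_le => i /andP[Yi _]; apply: Hv; apply: leq_trans Yi.
have H2 : Cmod (l - A) <= eps / 4.
  apply: (csum_Clim_tail _ _ _ _ Hl) => y.
  apply: Rle_trans (HY Y.+1 y _) => //.
  by apply: rsum_le => i /andP[Yi _]; apply: Hu; apply: leq_trans Yi.
rewrite (_ : A + T - l = T - (l - A))%C; last by ring.
have := Cmod_triangle T (- (l - A)); rewrite Cmod_opp => h.
by apply: Rle_lt_trans h _; lra.
Qed.

(** * The complex exponential *)

Lemma Cexp_plus z u : Cexp (z + u) = (Cexp z * Cexp u)%C.
Proof.
case: z u => [x y] [x' y']; rewrite /Cexp /= exp_plus cos_plus sin_plus.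
by rewrite /Cmult /=; congr pair; ring.
Qed.

Lemma Cexp_0 : Cexp 0 = 1.
Proof. by rewrite /Cexp /= exp_0 cos_0 sin_0 Rmult_1_l Rmult_0_r. Qed.

Lemma Cmod_Cexp z : Cmod (Cexp z) = exp (Re z).
Proof.
rewrite /Cmod /Cexp /=.
rewrite -[RHS](sqrt_Rsqr (exp (Re z))); last by left; apply: exp_pos.
congr sqrt; have := sin2_cos2 (Im z); rewrite /Rsqr => h.
transitivity (exp (Re z) * exp (Re z)
  * (sin (Im z) * sin (Im z) + cos (Im z) * cos (Im z))); first ring.
by rewrite h Rmult_1_r.
Qed.

Lemma Cexp_pow z n : (Cexp z ^ n)%C = Cexp (RtoC (INR n) * z).
Proof.
elim: n => [|n IH]; first by rewrite /= Cmult_0_l Cexp_0.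
rewrite Cpow_S IH -Cexp_plus S_INR RtoC_plus; congr Cexp; ring.
Qed.

(** Differentiation in a real parameter, by components, so that the real mean value theorem can be
    applied to real parts. *)
Definition is_path_derive (f : R -> C) (t : R) (d : C) : Prop :=
  is_derive (fun x => Re (f x)) t (Re d) /\
  is_derive (fun x => Im (f x)) t (Im d).

Lemma path_derive_ext f g t d :
  (forall x, f x = g x) -> is_path_derive f t d -> is_path_derive g t d.
Proof.
by move=> E [H1 H2]; split; [move: H1|move: H2]; apply: is_derive_ext => x; rewrite E.
Qed.

Lemma path_derive_plus f g t d e :
  is_path_derive f t d -> is_path_derive g t e ->
  is_path_derive (fun x => f x + g x)%C t (d + e)%C.
Proof.
move=> [F1 F2] [G1 G2]; split.
- by apply: (is_derive_plus (fun x => Re (f x)) (fun x => Re (g x))).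
- by apply: (is_derive_plus (fun x => Im (f x)) (fun x => Im (g x))).
Qed.

Lemma path_derive_scal c f t d :
  is_path_derive f t d -> is_path_derive (fun x => c * f x)%C t (c * d)%C.
Proof.
move=> [F1 F2]; split.
- apply: (is_derive_minus (fun x => Re c * Re (f x)) (fun x => Im c * Im (f x)));
    exact: is_derive_scal.
- apply: (is_derive_plus (fun x => Re c * Im (f x)) (fun x => Im c * Re (f x)));
    exact: is_derive_scal.
Qed.

Lemma path_derive_RtoC r t r' :
  is_derive r t r' -> is_path_derive (fun x => RtoC (r x)) t (RtoC r').
Proof. by move=> H; split=> //=; apply: is_derive_const. Qed.

Lemma path_derive_Cexp z t :
  is_path_derive (fun x => Cexp (RtoC x * z)) t (z * Cexp (RtoC t * z))%C.
Proof.
case: z => a b; apply: (path_derive_ext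
  (fun x => (exp (x * a) * cos (x * b), exp (x * a) * sin (x * b)))).
  by move=> x; rewrite /Cexp /=; congr (exp _ * cos _, exp _ * sin _); ring.
rewrite /is_path_derive /Cexp /= !Rmult_0_l Rminus_0_r Rplus_0_r.
by split; auto_derive => //; ring.
Qed.

Definition exp_sum (K : nat) (z : C) : C :=
  \csum_(0 <= k < K) (RtoC (/ INR (fact k)) * z ^ k).

Lemma exp_sumS K z :
  exp_sum K.+1 z = (exp_sum K z + RtoC (/ INR (fact K)) * z ^ K)%C.
Proof. by rewrite /exp_sum big_nat_recr. Qed.

Lemma is_derive_monomial c K x :
  is_derive (fun x => c * x ^ K.+1) x (c * (INR K.+1 * x ^ K)).
Proof. by auto_derive => //; rewrite Rmult_1_l. Qed.

Lemma path_derive_exp_sum K z t :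
  is_path_derive (fun x => exp_sum K.+1 (RtoC x * z)) t
    (z * exp_sum K (RtoC t * z))%C.
Proof.
elim: K => [|K IH].
  rewrite {2}/exp_sum big_geq // Cmult_0_r.
  apply: (path_derive_ext (fun _ => RtoC 1)).
    by move=> x; rewrite /exp_sum big_nat1 /= Rinv_1 Cmult_1_l.
  by apply: path_derive_RtoC; apply: is_derive_const.
apply: (path_derive_ext (fun x => exp_sum K.+1 (RtoC x * z)
  + (RtoC (/ INR (fact K.+1)) * z ^ K.+1) * RtoC (x ^ K.+1))%C).
  by move=> x; rewrite (exp_sumS K.+1) Cpow_mult_l RtoC_pow; ring.
rewrite exp_sumS.
have -> : (z * (exp_sum K (t * z) + RtoC (/ INR (fact K)) * (t * z) ^ K)
  = z * exp_sum K (t * z)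
    + (RtoC (/ INR (fact K.+1)) * z ^ K.+1) * RtoC (INR K.+1 * t ^ K))%C.
  have -> : / INR (fact K) = / INR (fact K.+1) * INR K.+1.
    rewrite fact_simpl mult_INR; field.
    by split; [exact: INR_fact_neq_0|exact: not_0_INR].
  by rewrite Cpow_mult_l !RtoC_mult RtoC_pow Cpow_S; ring.
apply: path_derive_plus => //.
apply: path_derive_scal; apply: path_derive_RtoC.
by have := is_derive_monomial 1 K t; rewrite Rmult_1_l; apply: is_derive_ext => x;
  rewrite Rmult_1_l.
Qed.

Lemma le_of_derive_le (f g f' g' : R -> R) (x : R) :
  0 <= x ->
  (forall t, is_derive f t (f' t)) -> (forall t, is_derive g t (g' t)) ->
  (forall t, 0 <= t <= x -> f' t <= g' t) -> f 0 <= g 0 -> f x <= g x.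
Proof.
move=> x0 Hf Hg H H0.
have D t : is_derive (fun u => g u - f u) t (g' t - f' t).
  exact: is_derive_minus.
have [c [Hc]] := MVT_gen (fun u => g u - f u) 0 x (fun t => g' t - f' t)
  (fun t _ => D t)
  (fun t _ => proj2 (continuity_pt_filterlim _ _)
     (ex_derive_continuous _ _ (ex_intro _ _ (D t)))).
rewrite Rmin_left // Rmax_right // in Hc => E.
have := Rmult_le_pos (g' c - f' c) (x - 0).
by have := H c Hc; lra.
Qed.

(** The choice [u = conj z / |z|] turns [Re (u z)] into [|z|]. This reduces an estimate of a modulus
    to real-valued functions, to which the mean value theorem applies. *)
Lemma Cmod_le_of_Re z B :
  (forall u, Cmod u <= 1 -> Re (u * z)%C <= B) -> Cmod z <= B.
Proof.
move=> H; case: (Req_dec (Cmod z) 0) => [z0|zn].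
  have := H 0; rewrite Cmod_0 Cmult_0_l z0 /=; apply; lra.
have zn' : RtoC (Cmod z) <> 0 by move=> /RtoC_inj.
have := H (Cconj z / Cmod z)%C.
rewrite Cmod_div // Cmod_conj Cmod_R (Rabs_pos_eq _ (Cmod_ge_0 z)).
rewrite Rdiv_diag // => /(_ (Rle_refl _)).
have -> : (Cconj z / Cmod z * z = RtoC (Cmod z))%C => //.
transitivity ((z * Cconj z) / Cmod z)%C; first by field.
by rewrite -Cmod2_conj RtoC_pow; field.
Qed.

Lemma exp_monotone x y : x <= y -> exp x <= exp y.
Proof. by case=> [/exp_increasing|->]; lra. Qed.

(** Along the segment from 0 to [z], the derivative of the remainder of order [K + 1] is [z] times
    the remainder of order [K]; comparing derivatives raises the order by one. *)
Lemma Cexp_taylor K z :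
  Cmod (Cexp z - exp_sum K z) <= Cmod z ^ K / INR (fact K) * exp (Cmod z).
Proof.
(* The factor [t ^ K] is what the induction integrates; [t = 1] is the claim. *)
suff H : forall t, 0 <= t <= 1 ->
    Cmod (Cexp (RtoC t * z) - exp_sum K (RtoC t * z))
    <= exp (Cmod z) * Cmod z ^ K / INR (fact K) * t ^ K.
  have := H 1; rewrite Cmult_1_l pow1 => h.
  by apply: Rle_trans (h _) _; [lra|right; rewrite /Rdiv; ring].
elim: K => [|K IH] t ht.
  rewrite /exp_sum big_geq // (_ : _ - 0 = Cexp (t * z))%C; last by ring.
  rewrite Cmod_Cexp /= Rdiv_1_r !Rmult_1_r; apply: exp_monotone.
  have := re_le_Cmod z; have := Rle_abs (Re z) => h1 h2.
  rewrite /= Rmult_0_l Rminus_0_r -/(Re z).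
  have h3 := Rmult_le_compat_l t _ _ (proj1 ht) (Rle_trans _ _ _ h1 h2).
  have := Rmult_le_compat_r _ _ _ (Cmod_ge_0 z) (proj2 ht); lra.
apply: Cmod_le_of_Re => u u1.
have D x : is_path_derive
    (fun x => u * (Cexp (RtoC x * z) - exp_sum K.+1 (RtoC x * z)))%C x
    (u * (z * (Cexp (RtoC x * z) - exp_sum K (RtoC x * z))))%C.
  apply: path_derive_scal.
  rewrite (_ : z * _ = z * Cexp (x * z) + (-1)%R * (z * exp_sum K (x * z)))%C;
    last by ring.
  apply: (path_derive_ext (fun x => Cexp (RtoC x * z)
    + (-1)%R * exp_sum K.+1 (RtoC x * z))%C); first by move=> y; ring.
  apply: path_derive_plus; first exact: path_derive_Cexp.
  by apply: path_derive_scal; apply: path_derive_exp_sum.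
apply: (le_of_derive_le _ (fun t => exp (Cmod z) * Cmod z ^ K.+1 / INR (fact K.+1) * t ^ K.+1)
  _ (fun t => exp (Cmod z) * Cmod z ^ K.+1 / INR (fact K) * t ^ K)
  t (proj1 ht) (fun x => proj1 (D x))).
- move=> x.
  have -> : exp (Cmod z) * Cmod z ^ K.+1 / INR (fact K) * x ^ K
      = exp (Cmod z) * Cmod z ^ K.+1 / INR (fact K.+1) * (INR K.+1 * x ^ K).
    rewrite fact_simpl mult_INR; field.
    by split; [exact: INR_fact_neq_0|exact: not_0_INR].
  exact: is_derive_monomial.
- move=> x hx.
  apply: Rle_trans (Rle_trans _ _ _ (Rle_abs _) (re_le_Cmod _)) _.
  rewrite !Cmod_mult.
  apply: Rle_trans (_ : 1 * (Cmod z * (exp (Cmod z) * Cmod z ^ K / INR (fact K) * x ^ K)) <= _).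
    apply: Rmult_le_compat => //; try exact: Cmod_ge_0.
      by apply: Rmult_le_pos; apply: Cmod_ge_0.
    apply: Rmult_le_compat_l; first exact: Cmod_ge_0.
    by apply: IH; lra.
  by right; rewrite /= /Rdiv; ring.
- rewrite (_ : RtoC 0 * z = 0)%C; last by ring.
  rewrite Cexp_0 (_ : exp_sum K.+1 0 = 1).
    by rewrite (_ : u * _ = 0)%C /=; [rewrite Rmult_0_l Rmult_0_r; lra|ring].
  elim: {IH D}K => [|K IH].
    by rewrite /exp_sum big_nat1 /= Rinv_1 Cmult_1_l.
  by rewrite exp_sumS IH Cpow_S; ring.
Qed.

(** * Cauchy estimates *)

Lemma csum_const m c : \csum_(0 <= j < m) c = (RtoC (INR m) * c)%C.
Proof.
elim: m => [|m IH]; first by rewrite big_geq // Cmult_0_l.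
by rewrite big_nat_recr //= IH -/(INR m.+1) S_INR RtoC_plus; ring.
Qed.

Lemma csum_geom q m : 
  ((q - 1) * (\csum_(0 <= j < m) (q ^ j)) = q ^ m - 1)%C.
Proof.
elim: m => [|m IH]; first by rewrite big_geq //=; ring.
by rewrite big_nat_recr //= Cmult_plus_distr_l IH; ring.
Qed.

Definition zeta (m : nat) : C := Cexp (0, 2 * PI / INR m).

Lemma zeta_pow m n : (zeta m ^ n)%C = Cexp (0, INR n * (2 * PI / INR m)).
Proof. by rewrite Cexp_pow; congr Cexp; rewrite /Cmult /=; congr pair; ring. Qed.

Lemma Cmod_zeta_pow m n : Cmod (zeta m ^ n)%C = 1.
Proof. by rewrite zeta_pow Cmod_Cexp /= exp_0. Qed.

Lemma zeta_pow_m m : (0 < m)%N -> (zeta m ^ m)%C = 1.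
Proof.
move=> /ltP m0; rewrite zeta_pow.
have -> : INR m * (2 * PI / INR m) = 2 * PI.
  by field; apply: not_0_INR => E; rewrite E in m0; inversion m0.
by rewrite /Cexp /= cos_2PI sin_2PI exp_0 Rmult_1_l Rmult_0_r.
Qed.

(** The real part is [1 - 2 sin^2 (pi e / m)], and the sine is positive because the angle lies
    strictly between 0 and [pi]. *)
Lemma zeta_pow_neq1 m e : (0 < e < m)%N -> (zeta m ^ e)%C <> 1.
Proof.
move=> /andP[/ltP/lt_INR e0 /ltP/lt_INR em].
have m0 : 0 < INR m by rewrite /= in e0; lra.
rewrite zeta_pow /Cexp /= exp_0 => -[H _].
have := sin_gt_0 (INR e * (PI / INR m)).
have P := PI_RGT_0.
move: H; rewrite (_ : INR e * (2 * PI / INR m) = 2 * (INR e * (PI / INR m)));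
  last by field; lra.
rewrite cos_2a_sin => H S.
have : 0 < sin (INR e * (PI / INR m)).
  apply: S.
    by apply: Rmult_lt_0_compat; [exact: e0|apply: Rdiv_lt_0_compat].
  rewrite -{2}(Rmult_1_r PI) (_ : INR e * (PI / INR m) = PI * (INR e / INR m));
    last by field; lra.
  apply: Rmult_lt_compat_l => //; apply: (Rmult_lt_reg_r (INR m)) => //.
  by rewrite /Rdiv Rmult_assoc Rinv_l; lra.
by move=> h; have := Rmult_lt_0_compat _ _ h h; lra.
Qed.

(** The exponent [m - k + l] stands for [l - k] modulo [m], kept nonnegative so that natural powers
    suffice. *)
Lemma zeta_orthogonality m k l : (k < m)%N -> (l < m)%N ->
  \csum_(0 <= j < m) ((zeta m ^ (m - k + l)) ^ j)
  = if l == k then RtoC (INR m) else RtoC 0.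
Proof.
move=> km lm; have m0 : (0 < m)%N by apply: leq_ltn_trans km.
case: eqP => [->|/eqP lk].
  rewrite subnK; last exact: ltnW.
  rewrite zeta_pow_m // (eq_bigr (fun _ => RtoC 1)).
    by rewrite csum_const Cmult_1_r.
  by move=> j _; rewrite Cpow_1_l.
(* Reduction of the exponent modulo [m] to a nonzero residue, whose geometric sum vanishes. *)
have [e he ->] : exists2 e, (0 < e < m)%N & (zeta m ^ (m - k + l) = zeta m ^ e)%C.
  case: (ltnP k l) => kl.
    exists (l - k)%N; first by rewrite subn_gt0 kl (leq_ltn_trans (leq_subr _ _)).
    have -> : (m - k + l = m + (l - k))%N.
      by rewrite addnBA ?(ltnW kl) // addnBAC // ltnW.
    by rewrite Cpow_add_r zeta_pow_m // Cmult_1_l.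
  have {lk}kl : (l < k)%N by rewrite ltn_neqAle lk.
  exists (m - k + l)%N => //.
  rewrite addn_gt0 subn_gt0 km /=.
  by rewrite -{2}(subnK (ltnW km)) ltn_add2l.
have E := csum_geom (zeta m ^ e) m.
have : ((zeta m ^ e) ^ m = 1)%C.
  by rewrite -Cpow_mult_r Nat.mul_comm Cpow_mult_r zeta_pow_m // Cpow_1_l.
move=> E1; move: E; rewrite E1 => E.
have N : (zeta m ^ e - 1)%C <> 0.
  move=> h; apply: (@zeta_pow_neq1 m e he).
  by transitivity (zeta m ^ e - 1 + 1)%C; [ring|rewrite h; ring].
rewrite -[LHS]Cmult_1_l -(Cinv_l _ N) -Cmult_assoc E; ring.
Qed.

Lemma csum_delta m k (F : nat -> C) : (k < m)%N ->
  \csum_(0 <= l < m) (if l == k then F l else RtoC 0) = F k.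
Proof.
move=> km; rewrite (bigD1_seq k) ?mem_index_iota ?iota_uniq //= eqxx big1.
  by rewrite Cplus_0_r.
by move=> i /negbTE ->.
Qed.

(** Uniform convergence of the power series on the closed disc: the error [e m] is the same for all
    [h]. It is the only form of analyticity that the Cauchy estimates below use. *)
Definition expands (f : C -> C) (a : nat -> C) (rho : R) : Prop :=
  exists e : nat -> R, is_lim_seq e 0 /\
    forall m h, Cmod h <= rho ->
      Cmod (f h - \csum_(0 <= l < m) (a l * h ^ l)) <= e m.

(* The coefficient a_k is extracted by averaging over the m-th roots of unity,
   which kills all other coefficients of index < m. *)
Lemma cauchy_coef f a rho B :
  0 <= rho -> expands f a rho -> (forall h, Cmod h <= rho -> Cmod (f h) <= B) ->
  forall k, Cmod (a k) * rho ^ k <= B.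
Proof.
move=> r0 [e [He H]] HB k.
have key m : (k < m)%N -> Cmod (a k) * rho ^ k <= B + e m.
  move=> km; have m0 : (0 < m)%N by apply: leq_ltn_trans km.
  pose P h := \csum_(0 <= l < m) (a l * h ^ l).
  pose x j := (RtoC rho * zeta m ^ j)%C.
  have xr j : Cmod (x j) <= rho.
    by rewrite Cmod_mult Cmod_zeta_pow Cmod_R Rabs_pos_eq //; lra.
  have PB j : Cmod (P (x j)) <= B + e m.
    have := H m (x j) (xr j); have := HB _ (xr j) => h1 h2.
    rewrite (_ : P (x j) = f (x j) + - (f (x j) - P (x j)))%C; last by ring.
    by apply: Rle_trans (Cmod_triangle _ _) _; rewrite Cmod_opp; apply: Rplus_le_compat.
  (* The weight [zeta ^ (j (m - k))] equals [zeta ^ (- j k)], the discrete form of the kernel in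
     Cauchy's coefficient formula. *)
  have W : \csum_(0 <= j < m) (zeta m ^ (j * (m - k)) * P (x j))
      = (RtoC (INR m) * (a k * RtoC (rho ^ k)))%C.
    transitivity (\csum_(0 <= l < m) (\csum_(0 <= j < m)
       (a l * RtoC (rho ^ l) * ((zeta m ^ (m - k + l)) ^ j)))).
      rewrite exchange_big_nat /=; apply: eq_bigr => j _.
      rewrite -csum_scal; apply: eq_bigr => l _.
      rewrite /x Cpow_mult_l RtoC_pow -!Cpow_mult_r.
      rewrite (_ : ((m - k + l) * j)%coq_nat = (j * (m - k) + j * l)%coq_nat)%N;
        last by rewrite !multE plusE -mulnDr mulnC.
      by rewrite Cpow_add_r multE; ring.
    rewrite (eq_big_nat _ _ (F2 := fun l => if l == k then
      (RtoC (INR m) * (a l * RtoC (rho ^ l)))%C else RtoC 0)).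
      exact: csum_delta.
    move=> l /andP[_ lm]; rewrite csum_scal zeta_orthogonality //.
    by case: eqP => _; ring.
  have := Cmod_csum 0 m (fun j => zeta m ^ (j * (m - k)) * P (x j))%C.
  rewrite W !Cmod_mult !Cmod_R (Rabs_pos_eq _ (pos_INR m)).
  rewrite (Rabs_pos_eq _ (pow_le _ _ r0)) => h.
  have {}h : INR m * (Cmod (a k) * rho ^ k) <= INR m * (B + e m).
    apply: Rle_trans h _.
    apply: Rle_trans (_ : \rsum_(0 <= j < m) (B + e m) <= _).
      by apply: rsum_le => j _; rewrite Cmod_mult Cmod_zeta_pow Rmult_1_l.
    right; apply: RtoC_inj; rewrite RtoC_rsum csum_const RtoC_mult //.
  by apply: Rmult_le_reg_l h; apply: lt_0_INR; apply/ltP.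
apply: (is_lim_seq_le_loc (fun _ => Cmod (a k) * rho ^ k) (fun m => B + e m)
  (Cmod (a k) * rho ^ k) B).
- by exists k.+1 => m /leP; apply: key.
- exact: is_lim_seq_const.
- rewrite -{2}(Rplus_0_r B); apply: is_lim_seq_plus' He; exact: is_lim_seq_const.
Qed.

(** The coefficient bound gives [|a_k h^k| <= B theta^k], so the terms from [K] to [m] are dominated
    by a geometric series; the error of the [m]-th partial sum disappears as [m] grows. *)
Lemma cauchy_remainder f a rho B theta K h :
  0 <= rho -> expands f a rho -> (forall h, Cmod h <= rho -> Cmod (f h) <= B) ->
  0 <= theta < 1 -> Cmod h <= theta * rho ->
  Cmod (f h - \csum_(0 <= k < K) (a k * h ^ k)) <= B * theta ^ K / (1 - theta).
Proof.
move=> r0 Hf HB [t0 t1] hh; have A := cauchy_coef _ _ _ _ r0 Hf HB.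
have hr : Cmod h <= rho.
  by apply: Rle_trans hh _; rewrite -{2}(Rmult_1_l rho); apply: Rmult_le_compat_r; lra.
have B0 : 0 <= B by apply: Rle_trans (Cmod_ge_0 _) (HB _ hr).
have [e [He H]] := Hf.
have term k : Cmod (a k * h ^ k)%C <= B * theta ^ k.
  rewrite Cmod_mult Cmod_pow.
  apply: Rle_trans (_ : Cmod (a k) * (theta * rho) ^ k <= _).
    apply: Rmult_le_compat_l; first exact: Cmod_ge_0.
    by apply: pow_incr; split=> //; apply: Cmod_ge_0.
  rewrite Rpow_mult_distr -Rmult_assoc (Rmult_comm _ (theta ^ k)) Rmult_assoc.
  rewrite (Rmult_comm B); apply: Rmult_le_compat_l; [exact: pow_le|exact: A].
have geo m : (K <= m)%N ->
    \rsum_(K <= k < m) (B * theta ^ k) <= B * theta ^ K / (1 - theta).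
  move=> Km; have E : \rsum_(K <= k < m) (B * theta ^ k)
      = B * (theta ^ K - theta ^ m) / (1 - theta).
    rewrite -(subnK Km); elim: (m - K)%N => [|n IH].
      by rewrite big_geq //= /Rminus Rplus_opp_r Rmult_0_r /Rdiv Rmult_0_l.
    by rewrite addSn big_nat_recr ?leq_addl //= IH; field; lra.
  rewrite E; apply: Rmult_le_compat_r.
    by left; apply: Rinv_0_lt_compat; lra.
  by apply: Rmult_le_compat_l => //; have := pow_le theta m t0; lra.
have key m : (K <= m)%N -> Cmod (f h - \csum_(0 <= k < K) (a k * h ^ k))
    <= B * theta ^ K / (1 - theta) + e m.
  move=> Km; have E := @big_cat_nat _ _ Cplus K 0 m xpredT (fun k => a k * h ^ k)%C isT Km.
  have := H m h hr; rewrite E /= => h1.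
  set S := \csum_(0 <= k < K) _ in h1 *; set T := \csum_(K <= k < m) _ in h1.
  rewrite (_ : f h - S = (f h - (S + T)) + T)%C; last by ring.
  apply: Rle_trans (Cmod_triangle _ _) _; rewrite Rplus_comm.
  apply: Rplus_le_compat => //; apply: Rle_trans (Cmod_csum _ _ _) _.
  by apply: Rle_trans (geo m Km); apply: rsum_le => k _; apply: term.
apply: (is_lim_seq_le_loc (fun _ => Cmod (f h - \csum_(0 <= k < K) (a k * h ^ k)))
  (fun m => B * theta ^ K / (1 - theta) + e m)
  (Cmod (f h - \csum_(0 <= k < K) (a k * h ^ k))) (B * theta ^ K / (1 - theta))).
- by exists K => m /leP; apply: key.
- exact: is_lim_seq_const.
- rewrite -{2}(Rplus_0_r (B * theta ^ K / (1 - theta))).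
  by apply: is_lim_seq_plus' He; exact: is_lim_seq_const.
Qed.

(** * Powers of integers *)

Lemma INR_gt0 n : (0 < n)%N -> 0 < INR n.
Proof. by move=> /ltP; apply: lt_0_INR. Qed.

Lemma Rpower_gt0 x y : 0 < Rpower x y.
Proof. exact: exp_pos. Qed.

Lemma Cmod_Dmono n s : Cmod (Dmono n s) = Rpower (INR n) (- Re s).
Proof. by rewrite /Dmono Cmod_Cexp /Rpower; congr exp; rewrite /= /Re; ring. Qed.

Lemma Dmono_1 s : Dmono 1 s = 1.
Proof. by rewrite /Dmono /= ln_1 Cmult_0_r (_ : - 0 = 0)%C ?Cexp_0 //; ring. Qed.

Lemma Dmono_mul m n s : (0 < m)%N -> (0 < n)%N ->
  Dmono (m * n) s = (Dmono m s * Dmono n s)%C.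
Proof.
move=> m0 n0; rewrite /Dmono -Cexp_plus -multE mult_INR.
rewrite ln_mult; try exact: INR_gt0.
by rewrite RtoC_plus; congr Cexp; ring.
Qed.

Lemma Dmono_plus n s h :
  Dmono n (s + h) = (Dmono n s * Cexp (RtoC (- ln (INR n)) * h))%C.
Proof. by rewrite /Dmono -Cexp_plus RtoC_opp; congr Cexp; ring. Qed.

Lemma Rpower_le_exponent n x y : (0 < n)%N -> x <= y ->
  Rpower (INR n) x <= Rpower (INR n) y.
Proof.
move=> n0 [xy|->]; last by lra.
case: n n0 => // -[_|n _].
  by rewrite /Rpower /= ln_1 !Rmult_0_r; lra.
left; apply: Rpower_lt => //; rewrite -[1]/(INR 1); apply: lt_INR.
by apply/ltP.
Qed.

(** Discrete form of comparing [q x^(-1-q)] with its integral over [[n, n+1]]; it rests on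
    [1/(n+1) <= ln (n+1) - ln n] and [1 + x <= exp x]. The right side telescopes. *)
Lemma Rpower_neg_step q n : 0 < q -> (0 < n)%N ->
  q * Rpower (INR n.+1) (- (1 + q))
  <= Rpower (INR n) (- q) - Rpower (INR n.+1) (- q).
Proof.
move=> q0 n0; have a0 := INR_gt0 _ n0; have b0 := INR_gt0 n.+1 isT.
have E1 : Rpower (INR n.+1) (- (1 + q)) = Rpower (INR n.+1) (- q) * / INR n.+1.
  rewrite Ropp_plus_distr Rpower_plus Rpower_Ropp Rpower_1 //; ring.
have E2 : Rpower (INR n) (- q)
    = Rpower (INR n.+1) (- q) * exp (q * (ln (INR n.+1) - ln (INR n))).
  by rewrite /Rpower -exp_plus; congr exp; ring.
have L : / INR n.+1 <= ln (INR n.+1) - ln (INR n).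
  rewrite -ln_div //.
  have := exp_ineq1_le (- ln (INR n.+1 / INR n)).
  rewrite exp_Ropp exp_ln; last exact: Rdiv_lt_0_compat.
  have -> : / (INR n.+1 / INR n) = 1 - / INR n.+1.
    by rewrite S_INR in b0 *; field; lra.
  lra.
rewrite E1 E2; have := exp_ineq1_le (q * (ln (INR n.+1) - ln (INR n))).
have := Rmult_le_compat_l _ _ _ (Rlt_le _ _ q0) L.
have P := Rpower_gt0 (INR n.+1) (- q) => h1 h2.
have := Rmult_le_compat_l _ _ _ (Rlt_le _ _ P) (Rle_trans _ _ _ (Rplus_le_compat_l 1 _ _ h1) h2).
lra.
Qed.

Lemma bounded_sums_Rpower q : 0 < q ->
  bounded_sums (fun n => Rpower (INR n) (- (1 + q))).
Proof.
move=> q0; split; first by move=> n _; left; apply: Rpower_gt0.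
(* The first term contributes 1, the telescoping sum at most [1 / q]. *)
exists ((q + 1) / q) => N.
have H : q * (\rsum_(1 <= n < N.+1) Rpower (INR n) (- (1 + q))) <= q + 1.
  case: N => [|N]; first by rewrite big_geq //; lra.
  apply: Rle_trans (_ : q + 1 - Rpower (INR N.+1) (- q) <= _); last first.
    by have := Rpower_gt0 (INR N.+1) (- q); lra.
  elim: N => [|N IH].
    by rewrite big_nat1 /= /Rpower ln_1 !Rmult_0_r exp_0; lra.
  have -> : \rsum_(1 <= n < N.+3) Rpower (INR n) (- (1 + q))
      = \rsum_(1 <= n < N.+2) Rpower (INR n) (- (1 + q))
        + Rpower (INR N.+2) (- (1 + q)) by rewrite big_nat_recr.
  rewrite Rmult_plus_distr_l.
  by have := Rpower_neg_step q N.+1 q0 isT; lra.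
apply: (Rmult_le_reg_l q) => //.
by rewrite (_ : q * ((q + 1) / q) = q + 1) //; field; lra.
Qed.

(** * Smooth numbers *)

Lemma next_primeP m : [/\ (m < next_prime m)%N, prime (next_prime m) &
  forall p, (m < p)%N -> prime p -> (next_prime m <= p)%N].
Proof.
rewrite /next_prime; case: ex_minnP => p /andP[mp pp] min; split=> // q mq pq.
by apply: min; rewrite mq.
Qed.

Lemma nth_primeS j : nth_prime j.+1 = next_prime (nth_prime j).
Proof. by []. Qed.

Lemma prime_nth_prime j : prime (nth_prime j).
Proof. by case: j => // j; rewrite nth_primeS; case: (next_primeP (nth_prime j)). Qed.

Lemma ltn_nth_prime j : (j < nth_prime j)%N.
Proof.
elim: j => // j IH; rewrite nth_primeS.
by case: (next_primeP (nth_prime j)) => H _ _; apply: leq_ltn_trans H.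
Qed.

Lemma nth_prime_surj p : prime p -> exists2 j, (j < p)%N & nth_prime j = p.
Proof.
move=> pp.
have H k : (exists2 j, (j < k)%N & nth_prime j = p) \/ (nth_prime k <= p)%N.
  elim: k => [|k [[j jk E]|]]; first by right; apply: prime_gt1.
    by left; exists j => //; apply: leqW.
  rewrite leq_eqVlt => /orP[/eqP E|lt]; first by left; exists k.
  right; rewrite nth_primeS.
  by case: (next_primeP (nth_prime k)) => _ _; apply.
case: (H p) => // h; have := ltn_nth_prime p.
by rewrite ltnNge h.
Qed.

(** Decidable form of [prime_span], through prime divisors instead of exponents, so that it can be
    used as a test inside sums. *)
Definition smooth (N n : nat) : bool :=
  (0 < n)%N && all [in map nth_prime (iota 0 N)] (primes n).

Lemma smooth_gt0 N n : smooth N n -> (0 < n)%N.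
Proof. by case/andP. Qed.

(** This single equation holds both closure properties of [<P_N>]: under products and under
    divisors. *)
Lemma smoothM N m n : smooth N (m * n) = smooth N m && smooth N n.
Proof.
rewrite /smooth muln_gt0; case: posnP => //= m0; case: posnP => //= n0.
  by rewrite andbF.
apply/allP/andP => [H|[/allP Hm /allP Hn] p].
  by split; apply/allP => p pm; apply: H; rewrite primesM // pm ?orbT.
by rewrite primesM // => /orP[/Hm|/Hn].
Qed.

Lemma smooth1 N : smooth N 1.
Proof. by []. Qed.

Lemma smooth_prime N j : (j < N)%N -> smooth N (nth_prime j).
Proof.
move=> jN; rewrite /smooth prime_gt0 ?prime_nth_prime //=.
rewrite primes_prime ?prime_nth_prime //= andbT; apply: map_f.
by rewrite mem_iota.
Qed.

Lemma smoothP N n : prime_span N n <-> smooth N n.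
Proof.
split=> [[alpha ->]|].
  elim/big_ind: _ => // [m k|j _]; first by rewrite smoothM => -> ->.
  elim: (alpha j) => // k IH.
  by rewrite expnS smoothM IH smooth_prime.
elim/ltn_ind: n => n IH sn.
case: (leqP n 1) => n1.
  have -> : n = 1%N by apply/eqP; rewrite eqn_leq n1 (smooth_gt0 _ _ sn).
  by exists (fun _ => 0%N); rewrite big1.
have n0 := ltnW n1; have pd := pdiv_dvd n; have pp := pdiv_prime n1.
have : pdiv n \in primes n by rewrite mem_primes pp n0.
case/andP: (sn) => _ /allP h /h /mapP[j]; rewrite mem_iota /= add0n => jN E.
have lt : (n %/ pdiv n < n)%N by apply: ltn_Pdiv => //; apply: prime_gt1.
have En := divnK pd.
have : smooth N (n %/ pdiv n) by move: sn; rewrite -{1}En smoothM => /andP[].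
case/(IH _ lt) => alpha Ea.
(* The least prime divisor of [n] is [nth_prime j]; dividing it out lowers only the exponent at
   [j]. *)
exists (fun i => (i == j) + alpha i)%N.
rewrite -En Ea E mulnC.
rewrite (bigD1 (Ordinal jN)) //= [in RHS](bigD1 (Ordinal jN)) //= eqxx mulnA expnS.
congr (_ * _)%N; apply: eq_bigr => i /negbTE ij.
by rewrite (_ : (i == j :> nat) = false) //; apply: contraFF ij => /eqP h';
  apply/eqP/val_inj.
Qed.

(** A prime divisor [p] of [n] has index below [p], hence below [n]. *)
Lemma smooth_eventually n : (0 < n)%N ->
  forall N, (n <= N)%N -> smooth N n.
Proof.
move=> n0 N nN; rewrite /smooth n0; apply/allP => p.
rewrite mem_primes => /and3P[pp _ pn].
have [j jp <-] := nth_prime_surj _ pp; apply: map_f; rewrite mem_iota add0n /=.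
by apply: leq_trans jp _; apply: leq_trans (dvdn_leq n0 pn) nN.
Qed.

Lemma smoothS N n : smooth N.+1 n -> smooth N n || (nth_prime N %| n)%N.
Proof.
case/andP=> n0 /allP H; case: (boolP (_ %| n)%N) => [_|nd]; first by rewrite orbT.
rewrite orbF /smooth n0; apply/allP => p pn.
have /mapP[j] := H p pn; rewrite mem_iota /= add0n ltnS leq_eqVlt => /orP[/eqP->|jN] E.
  by move: pn nd; rewrite mem_primes E => /and3P[_ _ ->].
by rewrite E; apply: map_f; rewrite mem_iota.
Qed.

Lemma smooth0 n : smooth 0 n -> n = 1%N.
Proof.
case/andP=> n0 /allP H; case: (leqP n 1) => n1.
  by apply/eqP; rewrite eqn_leq n1.
by have := H (pdiv n); rewrite mem_primes pdiv_prime // n0 pdiv_dvd => /(_ isT).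
Qed.

Lemma big_multiples (T : Type) (idx : T) (op : Monoid.law idx) m X (u : nat -> T) :
  (0 < m)%N ->
  \big[op/idx]_(1 <= n < X.+1) (if (m %| n)%N then u (n %/ m)%N else idx)
  = \big[op/idx]_(1 <= d < (X %/ m).+1) u d.
Proof.
move=> m0; elim: X => [|X IH]; first by rewrite div0n !big_geq.
rewrite big_nat_recr //= IH divnS //; case: (m %| X.+1)%N => /=.
  by rewrite add1n [in RHS]big_nat_recr.
by rewrite add0n Monoid.mulm1.
Qed.

(* Euler product: a smooth n for N+1 primes is either smooth for N primes or
   p_N times a smooth number, so S_{N+1} <= S_N + p_N^{-e} S_{N+1}. *)
Lemma bounded_sums_smooth N e : 0 < e ->
  bounded_sums (fun n => if smooth N n then Rpower (INR n) (- e) else 0).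
Proof.
move=> e0.
have pos M n : 0 <= (if smooth M n then Rpower (INR n) (- e) else 0).
  by case: ifP => _; [left; apply: Rpower_gt0|lra].
split=> //; elim: N => [|N [B HB]].
  exists 1 => -[|X]; first by rewrite big_geq //; lra.
  rewrite big_ltn // big_nat_cond big1 /=.
    by rewrite /Rpower ln_1 Rmult_0_r exp_0; lra.
  move=> i /andP[/andP[i1 _] _]; case: ifP => // /smooth0 E.
  by rewrite E in i1.
set p := nth_prime N; have p1 : (1 < p)%N by apply: prime_gt1; apply: prime_nth_prime.
have p0 := ltnW p1.
set r := Rpower (INR p) (- e).
have r1 : r < 1.
  rewrite /r /Rpower -exp_0; apply: exp_increasing.
  have : 0 < ln (INR p).
    by rewrite -ln_1; apply: ln_increasing; [lra|apply: (lt_INR 1); apply/ltP].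
  by move=> h; have := Rmult_lt_0_compat _ _ e0 h; lra.
exists (B / (1 - r)) => X.
set u := fun n => if smooth N.+1 n then Rpower (INR n) (- e) else 0.
set S := \rsum_(1 <= n < X.+1) _.
(* The sum over multiples of [p] runs to [X / p] and is enlarged to [X], so that the same finite [S]
   stands on both sides. Since [r < 1], solving for [S] gives a bound free of [X]. *)
have : S <= B + r * S.
  apply: Rle_trans (_ : \rsum_(1 <= n < X.+1)
    ((if smooth N n then Rpower (INR n) (- e) else 0) +
     r * (if (p %| n)%N then u (n %/ p)%N else 0)) <= _).
    apply: rsum_le => n /andP[n1 _]; case: ifP => sn; last first.
      apply: Rplus_le_le_0_compat => //; apply: Rmult_le_pos.
        by left; apply: Rpower_gt0.
      by case: ifP => _; [exact: pos|lra].
    case/orP: (smoothS _ _ sn) => [->|pn].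
      have : 0 <= r * (if (p %| n)%N then u (n %/ p)%N else 0).
        apply: Rmult_le_pos; first by left; apply: Rpower_gt0.
        by case: ifP => _; [exact: pos|lra].
      lra.
    rewrite pn /u.
    have En := divnK pn.
    have -> : smooth N.+1 (n %/ p) by move: sn; rewrite -{1}En smoothM => /andP[].
    move: (pos N n); have -> : Rpower (INR n) (- e) = r * Rpower (INR (n %/ p)) (- e).
      rewrite -{1}En -multE mult_INR Rpower_mult_distr ?(Rmult_comm (INR p)) //.
        exact: INR_gt0.
      by apply: INR_gt0; rewrite divn_gt0 // dvdn_leq.
    lra.
  rewrite big_split rsum_scal /= big_multiples //.
  apply: Rplus_le_compat => //; apply: Rmult_le_compat_l.
    by left; apply: Rpower_gt0.
  by apply: rsum_mono_r => [//||i _]; [rewrite ltnS leq_div|apply: pos].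
move=> h; apply: (Rmult_le_reg_r (1 - r)); first by lra.
rewrite (_ : B / (1 - r) * (1 - r) = B); last by field; lra.
lra.
Qed.

(** * Dirichlet series *)

Lemma is_Dsum_Clim a s l :
  is_Dsum a s l <-> Clim (fun N => \csum_(1 <= n < N.+1) (a n * Dmono n s)) l.
Proof. exact: (is_series_Clim (fun n => a n * Dmono n s)%C). Qed.

Lemma is_Dsum_ext a b s l :
  (forall n, (0 < n)%N -> a n = b n) -> is_Dsum a s l -> is_Dsum b s l.
Proof.
move=> H; rewrite !is_Dsum_Clim; apply: Clim_ext => N.
by apply: eq_big_nat => n /andP[n0 _]; rewrite H.
Qed.

Lemma is_Dsum_scal k a s l :
  is_Dsum a s l -> is_Dsum (fun n => k * a n)%C s (k * l)%C.
Proof.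
rewrite !is_Dsum_Clim => /(Clim_scal k); apply: Clim_ext => N.
by rewrite -csum_scal; apply: eq_bigr => n _; ring.
Qed.

Lemma is_Dsum_plus a b s l l' : is_Dsum a s l -> is_Dsum b s l' ->
  is_Dsum (fun n => a n + b n)%C s (l + l')%C.
Proof.
rewrite !is_Dsum_Clim => H /(Clim_plus _ _ _ _ H); apply: Clim_ext => N.
by rewrite -big_split; apply: eq_bigr => n _ /=; ring.
Qed.

Lemma is_Dsum_finite X (a : nat -> C) s : (forall n, (X < n)%N -> a n = 0) ->
  is_Dsum a s (\csum_(1 <= n < X.+1) (a n * Dmono n s)).
Proof.
move=> H; apply/is_Dsum_Clim/Clim_eps => eps e0; exists X => N XN.
rewrite (@big_cat_nat _ _ _ X.+1) //= [Y in (_ + Y)%C]big_nat_cond [Y in (_ + Y)%C]big1.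
  by rewrite Cplus_0_r /Cminus Cplus_opp_r Cmod_0.
by move=> n /andP[/andP[Xn _] _]; rewrite H // Cmult_0_l.
Qed.

(* Multiplying by n_0^s and letting s tend to infinity isolates the first
   nonzero coefficient. *)
Lemma Dirichlet_unique0 a sigma :
  (forall s, half_plane sigma s -> is_Dsum a s 0) ->
  forall n, (0 < n)%N -> a n = 0.
Proof.
move=> H n; elim/ltn_ind: n => n IH n0.
(* The terms at [sigma + 1] are differences of consecutive partial sums, which are bounded. *)
have [B HB] : exists B, forall k, (0 < k)%N ->
    Cmod (a k) * Rpower (INR k) (- (sigma + 1)) <= B.
  have H1 : half_plane sigma (RtoC (sigma + 1)) by rewrite /half_plane /=; lra.
  have /is_Dsum_Clim/Clim_bounded [B HB] := H _ H1.
  exists (B + B) => -[//|k] _.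
  have := Cmod_triangle (\csum_(1 <= n < k.+2) (a n * Dmono n (RtoC (sigma + 1))))
    (- \csum_(1 <= n < k.+1) (a n * Dmono n (RtoC (sigma + 1)))).
  rewrite {1}big_nat_recr //= (_ : forall x y : C, x + y + - x = y)%C;
    last by move=> x y; ring.
  rewrite Cmod_opp Cmod_mult Cmod_Dmono.
  by have := HB k; have := HB k.+1; rewrite /=; lra.
have B0 : 0 <= B.
  apply: Rle_trans (HB n n0); apply: Rmult_le_pos; first exact: Cmod_ge_0.
  by left; apply: Rpower_gt0.
have [_ [K HK]] := bounded_sums_Rpower 1 Rlt_0_1.
have a0 := INR_gt0 _ n0; have b0 := INR_gt0 n.+1 isT.
have [q [q0 qn qk]] : exists q, [/\ 0 < q, INR n * q < 1 &
    forall k, (n < k)%N -> / INR k <= q].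
  exists (/ INR n.+1); split; first exact: Rinv_0_lt_compat.
    apply: (Rmult_lt_reg_r (INR n.+1)) => //.
    by rewrite Rmult_assoc Rinv_l; [rewrite S_INR|]; lra.
  by move=> k nk; apply: Rinv_le_contravar => //; apply: le_INR; apply/leP.
pose r := INR n * q.
(* At [sigma + 3 + t], the part [sigma + 1] absorbs the coefficients, 2 makes the tail summable, and
   [t] gives decay: each [k > n] loses [(n / k) ^ t] against [n], at most [r ^ t] with
   [r = n / (n + 1)]. *)
have key t : Cmod (a n) * Rpower (INR n) (- (sigma + 3)) <= B * K * r ^ t.
  pose s := RtoC (sigma + 3 + INR t).
  have hs : half_plane sigma s by rewrite /half_plane /=; have := pos_INR t; lra.
  have := Clim_minus _ _ _ _ (proj1 (is_Dsum_Clim _ _ _) (H s hs))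
    (Clim_const (a n * Dmono n s)).
  move=> /(Clim_Cmod_le _ _ (B * K * q ^ t) n) h.
  have {h} : Cmod (0 - a n * Dmono n s) <= B * K * q ^ t.
    apply: h => N nN.
    rewrite (@big_cat_nat _ _ _ n.+1) //= big_nat_recr //= big_nat_cond big1; last first.
      by move=> i /andP[/andP[i0 i_n] _]; rewrite IH // Cmult_0_l.
    rewrite (_ : forall x y : C, 0 + x + y - x = y)%C; last by move=> x y; ring.
    apply: Rle_trans (Cmod_csum _ _ _) _.
    apply: Rle_trans (_ : \rsum_(n.+1 <= k < N.+1)
      (B * q ^ t * Rpower (INR k) (- (1 + 1))) <= _).
      apply: rsum_le => k /andP[nk _].
      have k0 : (0 < k)%N by apply: leq_ltn_trans nk.
      have kp := INR_gt0 _ k0.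
      rewrite Cmod_mult Cmod_Dmono /=.
      have -> : - (sigma + 3 + INR t) = - (sigma + 1) + (- (1 + 1) + - INR t) by ring.
      rewrite Rpower_plus (Rpower_plus (- (1 + 1))) (Rpower_Ropp _ (INR t)).
      rewrite Rpower_pow // -Rmult_assoc.
      have -> : B * q ^ t * Rpower (INR k) (- (1 + 1))
         = B * (Rpower (INR k) (- (1 + 1)) * q ^ t) by ring.
      apply: Rmult_le_compat; [| |exact: HB|].
      - by apply: Rmult_le_pos; [exact: Cmod_ge_0|left; apply: Rpower_gt0].
      - apply: Rmult_le_pos; first by left; apply: Rpower_gt0.
        by left; apply: Rinv_0_lt_compat; apply: pow_lt.
      - apply: Rmult_le_compat_l; first by left; apply: Rpower_gt0.
        rewrite -pow_inv; apply: pow_incr; split; last exact: qk.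
        by left; apply: Rinv_0_lt_compat.
    rewrite rsum_scal; rewrite (Rmult_assoc B K) (Rmult_comm K) -Rmult_assoc.
    apply: Rmult_le_compat_l.
      by apply: Rmult_le_pos => //; apply: pow_le; lra.
    apply: Rle_trans (HK N); case: (leqP n.+1 N.+1) => nN'.
      rewrite [X in _ <= X](@big_cat_nat _ _ _ n.+1) //=.
      have := @rsum_ge0 1 n.+1 (fun k => Rpower (INR k) (- (1 + 1))).
      move=> /(_ (fun i _ => Rlt_le _ _ (Rpower_gt0 _ _))); lra.
    by rewrite ltnS leqNgt ltnS nN in nN'.
  rewrite (_ : 0 - a n * Dmono n s = - (a n * Dmono n s))%C; last by ring.
  rewrite Cmod_opp Cmod_mult Cmod_Dmono /=.
  rewrite Ropp_plus_distr Rpower_plus Rpower_Ropp (Rpower_Ropp _ (INR t)) Rpower_pow //.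
  move=> h; have := Rmult_le_compat_r _ _ _ (pow_le _ t (Rlt_le _ _ a0)) h.
  rewrite -Rpower_Ropp Rmult_assoc Rmult_assoc Rinv_l; last exact/pow_nonzero/Rgt_not_eq.
  rewrite Rmult_1_r /r Rpow_mult_distr; lra.
have r01 : Rabs r < 1.
  by rewrite Rabs_pos_eq //; left; apply: Rmult_lt_0_compat.
have := is_lim_seq_le _ (fun t => B * K * r ^ t)
  (Cmod (a n) * Rpower (INR n) (- (sigma + 3))) (B * K * 0) key
  (is_lim_seq_const _) (is_lim_seq_scal_l _ (B * K) 0 (is_lim_seq_geom _ r01)).
rewrite /= Rmult_0_r => h; apply: Cmod_eq_0; apply: Rle_antisym; last exact: Cmod_ge_0.
by apply: (Rmult_le_reg_r _ _ _ (Rpower_gt0 (INR n) (- (sigma + 3)))); lra.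
Qed.

Lemma Dirichlet_unique a b sigma (f : C -> C) :
  (forall s, half_plane sigma s -> is_Dsum a s (f s)) ->
  (forall s, half_plane sigma s -> is_Dsum b s (f s)) ->
  forall n, (0 < n)%N -> a n = b n.
Proof.
move=> Ha Hb n n0.
have : (a n + (-1)%R * b n)%C = 0.
  apply: (Dirichlet_unique0 (fun n => a n + (-1)%R * b n)%C sigma _ n n0) => s hs.
  rewrite (_ : RtoC 0 = f s + (-1)%R * f s)%C; last by ring.
  by apply: is_Dsum_plus; [exact: Ha|apply: is_Dsum_scal; apply: Hb].
by move=> E; transitivity (a n + (-1)%R * b n + b n)%C; [ring|rewrite E; ring].
Qed.

(** Dirichlet convolution with [f] cut off at [X], summed over the terms of [f] and not over the
    divisors of [n]. The product is thus a finite sum of dilated series and converges wherever the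
    series of [c] does. *)
Definition conv (X : nat) (f c : nat -> C) (n : nat) : C :=
  \csum_(1 <= m < X.+1) (f m * (if (m %| n)%N then c (n %/ m)%N else 0)).

Lemma is_Dsum_dilate c m s l : (0 < m)%N -> is_Dsum c s l ->
  is_Dsum (fun n => if (m %| n)%N then c (n %/ m)%N else 0) s (Dmono m s * l)%C.
Proof.
move=> m0; rewrite !is_Dsum_Clim => H.
have {}H := Clim_scal (Dmono m s) _ _ H.
have {H} := Clim_subseq _ _ (fun X => X %/ m)%N _ H.
have hm A : exists B, forall n, (B <= n)%N -> (A <= n %/ m)%N.
  by exists (A * m)%N => n; rewrite leq_divRL.
move=> /(_ hm); apply: Clim_ext => X.
rewrite -csum_scal.
pose u d := (c d * Dmono (m * d) s)%C.
transitivity (\csum_(1 <= d < (X %/ m).+1) u d).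
  by apply: eq_big_nat => d /andP[d0 _]; rewrite /u Dmono_mul //; ring.
rewrite -(big_multiples _ _ Cplus m X u m0); apply: eq_bigr => n _.
case: ifP => [mn|_]; last by ring.
by rewrite /u mulnC divnK.
Qed.

Lemma is_Dsum_conv X f c s l : is_Dsum c s l ->
  is_Dsum (conv X f c) s ((\csum_(1 <= m < X.+1) (f m * Dmono m s)) * l)%C.
Proof.
move=> H; elim: X => [|X IH].
  rewrite big_geq // Cmult_0_l.
  have := is_Dsum_scal 0 _ _ _ H; rewrite Cmult_0_l.
  by apply: is_Dsum_ext => n _; rewrite /conv big_geq // Cmult_0_l.
rewrite big_nat_recr //= Cmult_plus_distr_r -Cmult_assoc.
have := is_Dsum_plus _ _ _ _ _ IH
  (is_Dsum_scal (f X.+1) _ _ _ (is_Dsum_dilate c X.+1 s l isT H)).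
by apply: is_Dsum_ext => n _; rewrite /conv [in RHS]big_nat_recr.
Qed.

(** For smooth [n] every cofactor [n / m] is smooth, so nothing changes; otherwise [m] or [n / m]
    fails to be smooth, and each term vanishes through [f] or through the cut-off [c]. *)
Lemma conv_smooth N X (f c : nat -> C) n : (0 < n)%N ->
  (forall m, ~~ smooth N m -> f m = 0) ->
  (if smooth N n then conv X f c n else 0)
  = conv X f (fun d => if smooth N d then c d else 0) n.
Proof.
move=> n0 Hf; rewrite /conv; case: ifP => sn.
  apply: eq_bigr => m _; case: ifP => // mn.
  by move: sn; rewrite -{1}(divnK mn) smoothM => /andP[-> _].
rewrite big1 // => m _; case: ifP => mn; last by ring.
move: sn; rewrite -{1}(divnK mn) smoothM; case: ifP => _; last by move=> _; ring.
by move=> /= /negbT /Hf ->; rewrite Cmult_0_l.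
Qed.

(** * Multipliers *)

Lemma is_lim_seq_stationary (u : nat -> R) X l :
  (forall n, (X <= n)%N -> u n = l) -> is_lim_seq u l.
Proof.
move=> H; apply: (is_lim_seq_ext_loc (fun _ => l)); last exact: is_lim_seq_const.
by exists X => n /leP /H.
Qed.

Lemma is_series_finite X (u : nat -> R) : (forall n, (X < n)%N -> u n = 0) ->
  is_series (fun k => u (S k)) (\rsum_(1 <= n < X.+1) u n).
Proof.
move=> H; apply/is_series_rsum/(is_lim_seq_stationary _ X) => N XN.
rewrite (@big_cat_nat _ _ _ X.+1) //= [Y in _ + Y]big_nat_cond [Y in _ + Y]big1.
  exact: Rplus_0_r.
by move=> n /andP[/andP[Xn _] _]; apply: H.
Qed.

Lemma wl2_finite w X a : (forall n, (X < n)%N -> a n = RtoC 0) -> wl2 w a.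
Proof.
move=> H; exists (\rsum_(1 <= n < X.+1) (Cmod (a n) ^ 2 * w n)).
apply: (is_series_finite X (fun n => Cmod (a n) ^ 2 * w n)) => n /H ->.
by rewrite Cmod_0; ring.
Qed.

Lemma wnorm_finite w X a : (forall n, (X < n)%N -> a n = RtoC 0) ->
  wnorm w a = sqrt (\rsum_(1 <= n < X.+1) (Cmod (a n) ^ 2 * w n)).
Proof.
move=> H; rewrite /wnorm; congr sqrt; apply: is_series_unique.
apply: (is_series_finite X (fun n => Cmod (a n) ^ 2 * w n)) => n /H ->.
by rewrite Cmod_0; ring.
Qed.

Lemma wnorm_scal w k a : 0 <= k -> wnorm w (fun n => RtoC k * a n)%C = k * wnorm w a.
Proof.
move=> k0; rewrite /wnorm (Series_ext _ (fun n => k ^ 2 * (Cmod (a n.+1) ^ 2 * w n.+1))).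
  rewrite Series_scal_l sqrt_mult_alt; last exact: pow2_ge_0.
  by rewrite sqrt_pow2.
by move=> n; rewrite Cmod_mult Cmod_R Rabs_pos_eq //; ring.
Qed.

Lemma Hw_repr_scal w sigma0 k a f : Hw_repr w sigma0 a f ->
  Hw_repr w sigma0 (fun n => RtoC k * a n)%C (fun s => RtoC k * f s)%C.
Proof.
move=> [Ha Hf]; split; last by move=> s hs; apply: is_Dsum_scal; apply: Hf.
apply: ex_series_ext (ex_series_scal_l (k ^ 2) _ Ha) => n.
by rewrite Cmod_mult Cmod_R Rpow_mult_distr pow2_abs Rmult_assoc.
Qed.

Lemma Hw_repr_ext w sigma0 a f g : (forall s, f s = g s) ->
  Hw_repr w sigma0 a f -> Hw_repr w sigma0 a g.
Proof. by move=> E [Ha Hf]; split=> // s hs; rewrite -E; apply: Hf. Qed.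

Lemma mult_norm_ge w sigma0 phi a b f :
  Hw_repr w sigma0 a f -> Hw_repr w sigma0 b (fun s => Cmult (phi s) (f s)) ->
  0 < wnorm w a ->
  Rbar_le (wnorm w b / wnorm w a) (mult_norm w sigma0 phi).
Proof.
move=> Ha Hb a0.
have k0 : 0 <= / wnorm w a by left; apply: Rinv_0_lt_compat.
apply: (proj1 (Lub_Rbar_correct _)).
exists (fun s => RtoC (/ wnorm w a) * f s)%C,
  (fun n => RtoC (/ wnorm w a) * a n)%C, (fun n => RtoC (/ wnorm w a) * b n)%C.
split; first exact: Hw_repr_scal.
split; first by rewrite wnorm_scal // Rinv_l; lra.
split; last by rewrite wnorm_scal // /Rdiv Rmult_comm.
apply: Hw_repr_ext (Hw_repr_scal _ _ (/ wnorm w a) _ _ Hb) => s; ring.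
Qed.

(** * Evaluation of smooth parts and the kernel test *)

Definition smooth_part (N : nat) (c : nat -> C) (n : nat) : C :=
  if smooth N n then c n else RtoC 0.

(* The weights of the reproducing kernel of the smooth part of H^w. *)
Definition kernel_term (w : nat -> R) (N : nat) (x : R) (n : nat) : R :=
  if smooth N n then / w n * Rpower (INR n) (- 2 * x) else 0.

Lemma kernel_term_ge0 w N x n : (forall n, (0 < n)%N -> 0 < w n) ->
  0 <= kernel_term w N x n.
Proof.
move=> hw; rewrite /kernel_term; case: ifP => [/smooth_gt0 n0|_]; last by lra.
apply: Rmult_le_pos; last by left; apply: Rpower_gt0.
by left; apply: Rinv_0_lt_compat; apply: hw.
Qed.

Lemma Cmod_Dmono_sq n s : Cmod (Dmono n s) ^ 2 = Rpower (INR n) (- 2 * Re s).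
Proof. by rewrite Cmod_Dmono /Rpower /= Rmult_1_r -exp_plus; congr exp; ring. Qed.

(** Boundedness of point evaluation on the smooth part: Cauchy-Schwarz after splitting each term as
    [|b_n| sqrt(w_n)] times [|n^{-s}| / sqrt(w_n)]. *)
Lemma smooth_sum_bound w N s b Y E :
  (forall n, (0 < n)%N -> 0 < w n) -> wl2 w b ->
  \rsum_(1 <= n < Y.+1) kernel_term w N (Re s) n <= E ->
  Cmod (\csum_(1 <= n < Y.+1) (smooth_part N b n * Dmono n s))
  <= wnorm w b * sqrt E.
Proof.
move=> hw Hb HE.
apply: Rle_trans (Cmod_csum _ _ _) _.
have E0 : 0 <= \rsum_(1 <= n < Y.+1) kernel_term w N (Re s) n.
  by apply: rsum_ge0 => n _; apply: kernel_term_ge0.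
have := rsum_cauchy_schwarz 1 Y.+1 (fun n => Cmod (b n) * sqrt (w n))
  (fun n => sqrt (kernel_term w N (Re s) n)).
have -> : \rsum_(1 <= n < Y.+1) (Cmod (b n) * sqrt (w n) * sqrt (kernel_term w N (Re s) n))
    = \rsum_(1 <= n < Y.+1) Cmod (smooth_part N b n * Dmono n s).
  apply: eq_big_nat => n /andP[n0 _].
  rewrite /kernel_term /smooth_part; case: ifP => _; last first.
    by rewrite sqrt_0 Cmult_0_l Cmod_0; ring.
  have wn := hw n n0.
  rewrite -Cmod_Dmono_sq Rmult_assoc -sqrt_mult_alt; last by lra.
  rewrite -Rmult_assoc Rinv_r ?Rmult_1_l; last by lra.
  by rewrite sqrt_pow2 ?Cmod_mult //; apply: Cmod_ge_0.
set T := \rsum_(1 <= n < Y.+1) Cmod _ => h.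
apply: Rsqr_incr_0_var; last by apply: Rmult_le_pos; apply: sqrt_pos.
rewrite !Rsqr_pow2; apply: Rle_trans h _.
rewrite Rpow_mult_distr; apply: Rmult_le_compat.
- by apply: rsum_ge0 => n _; apply: pow2_ge_0.
- by apply: rsum_ge0 => n _; apply: pow2_ge_0.
- have pos n : (0 < n)%N -> 0 <= Cmod (b n) ^ 2 * w n.
    by move=> n0; apply: Rmult_le_pos; [apply: pow2_ge_0|left; apply: hw].
  have le := rsum_le_Series (fun n => Cmod (b n) ^ 2 * w n) Y pos Hb.
  rewrite /wnorm pow2_sqrt; last first.
    by apply: Rle_trans le; apply: rsum_ge0 => n /andP[n0 _]; apply: pos.
  apply: Rle_trans le; right; apply: eq_big_nat => n /andP[n0 _].
  by rewrite Rpow_mult_distr pow2_sqrt //; left; apply: hw.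
- rewrite pow2_sqrt; last by apply: Rle_trans HE.
  apply: Rle_trans HE; right; apply: eq_big_nat => n /andP[n0 _].
  by rewrite pow2_sqrt //; apply: kernel_term_ge0.
Qed.

(* Testing the multiplier on the truncations F_X of the reproducing kernel at s
   of the smooth part of H^w, for which F_X(s) = ||F_X||^2 = E_X. *)
Lemma smooth_part_bound w sigma0 phi c N s l (M : R) :
  (forall n, (0 < n)%N -> 0 < w n) -> multiplier w sigma0 phi ->
  (forall z, half_plane sigma0 z -> is_Dsum c z (phi z)) ->
  bounded_sums (kernel_term w N (Re s)) ->
  Rbar_le (mult_norm w sigma0 phi) M ->
  is_Dsum (smooth_part N c) s l -> Cmod l <= M.
Proof.
move=> hw hphi Hc He HM Hl.
have [e0 _] := He.
set e := kernel_term w N (Re s) in He e0.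
have [E HE] := bounded_sums_summable _ He.
have {}HE := proj1 (is_series_rsum _ _) HE.
have leE X : \rsum_(1 <= n < X.+1) e n <= E.
  apply: (is_lim_seq_incr_compare _ _ HE) => n.
  by apply: rsum_mono_r => // i; apply: e0.
have e1 : 0 < e 1%N.
  rewrite /e /kernel_term smooth1; apply: Rmult_lt_0_compat; last exact: Rpower_gt0.
  by apply: Rinv_0_lt_compat; apply: hw.
have posE X : 0 < \rsum_(1 <= n < X.+2) e n.
  by apply: Rlt_le_trans e1 _; apply: rsum_term_le => // i; apply: e0.
(* The cut is at [X + 1] so that [n = 1] is always included, which makes the kernel sum and the norm
   of the test function positive. *)
have key X : sqrt (\rsum_(1 <= n < X.+2) e n) * Cmod l <= M * sqrt E.
  set EX := \rsum_(1 <= n < X.+2) e n.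
  have EX0 : 0 < EX by apply: posE.
  pose f m := if smooth N m && (m <= X.+1)%N
    then (Cconj (Dmono m s) * RtoC (/ w m))%C else RtoC 0.
  have fX n : (X.+1 < n)%N -> f n = RtoC 0.
    by rewrite /f ltnNge => /negbTE ->; rewrite andbF.
  pose F z := \csum_(1 <= m < X.+2) (f m * Dmono m z).
  have HF : Hw_repr w sigma0 f F.
    by split=> [|z _]; [apply: wl2_finite fX|apply: is_Dsum_finite].
  have Fs : F s = RtoC EX.
    rewrite /F /EX RtoC_rsum; apply: eq_big_nat => m /andP[m0 mX].
    rewrite /f /e /kernel_term -ltnS mX andbT; case: ifP => _; last by rewrite Cmult_0_l.
    rewrite -Cmod_Dmono_sq RtoC_mult Cmod2_conj; ring.
  have nf : wnorm w f = sqrt EX.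
    rewrite (wnorm_finite w X.+1) //; congr sqrt; apply: eq_big_nat => m /andP[m0 mX].
    rewrite /f /e /kernel_term -ltnS mX andbT; case: ifP => _; last by rewrite Cmod_0; ring.
    rewrite Cmod_mult Cmod_conj Cmod_R Rpow_mult_distr Cmod_Dmono_sq pow2_abs.
    by field; have := hw m m0; lra.
  have [b Hb] := hphi F (ex_intro _ f HF).
  have nb : wnorm w b <= M * sqrt EX.
    have := mult_norm_ge _ _ _ _ _ _ HF Hb; rewrite nf => /(_ (sqrt_lt_R0 _ EX0)) h.
    have /= {}h := Rbar_le_trans _ _ _ h HM.
    have := Rmult_le_compat_r _ _ _ (sqrt_pos EX) h.
    by rewrite /Rdiv Rmult_assoc Rinv_l ?Rmult_1_r //; apply/Rgt_not_eq/sqrt_lt_R0.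
  (* Uniqueness in the far half-plane turns the membership of [phi F] in the space, a statement
     about functions, into one about coefficients, which can then be summed at [s] even when [s]
     lies further left. *)
  have Eb n : (0 < n)%N -> conv X.+1 f c n = b n.
    apply: (Dirichlet_unique _ _ sigma0 (fun z => phi z * F z)%C); last exact: (proj2 Hb).
    by move=> z hz; rewrite Cmult_comm; apply: is_Dsum_conv; apply: Hc.
  have : is_Dsum (smooth_part N b) s (F s * l)%C.
    apply: is_Dsum_ext (is_Dsum_conv X.+1 f _ _ _ Hl) => n n0.
    rewrite -(conv_smooth N) // /smooth_part; first by case: ifP => // _; rewrite Eb.
    by move=> m /negbTE sm; rewrite /f sm.
  move=> /is_Dsum_Clim /(Clim_Cmod_le _ _ (wnorm w b * sqrt E) 0) h.
  have {}h : Cmod (F s * l)%C <= wnorm w b * sqrt E.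
    apply: h => Y _; apply: smooth_sum_bound => //; exact: (proj1 Hb).
  rewrite Cmod_mult Fs Cmod_R Rabs_pos_eq in h; last by lra.
  have {}h := Rle_trans _ _ _ h (Rmult_le_compat_r _ _ _ (sqrt_pos E) nb).
  apply: (Rmult_le_reg_l (sqrt EX)); first exact: sqrt_lt_R0.
  rewrite -Rmult_assoc sqrt_sqrt; last by lra.
  by apply: Rle_trans h _; right; ring.
have E0 : 0 < E by apply: Rlt_le_trans (posE 0%N) (leE 1%N).
apply: (Rmult_le_reg_l (sqrt E)); first exact: sqrt_lt_R0.
rewrite (Rmult_comm _ M).
apply: (is_lim_seq_le _ _ (sqrt E * Cmod l) (M * sqrt E) key _ (is_lim_seq_const _)).
apply: (is_lim_seq_scal_r _ (Cmod l) (sqrt E)).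
apply: (is_lim_seq_continuous sqrt (fun X => \rsum_(1 <= n < X.+2) e n)).
  by apply: continuity_pt_sqrt; lra.
exact: (proj1 (is_lim_seq_incr_1 (fun X => \rsum_(1 <= n < X.+1) e n) E)).
Qed.

(** * Normal families *)

(** A quadratic error is [o(h)]; [Rabs c0 + 1] replaces [c0] to give a positive divisor when
    choosing the radius. *)
Lemma ex_derive_of_quadratic (g : C -> C) (s D : C) (c0 r : R) :
  0 < r ->
  (forall h, Cmod h <= r -> Cmod (g (s + h) - g s - D * h)%C <= c0 * Cmod h ^ 2) ->
  ex_derive g s.
Proof.
move=> r0 H; exists D; split; first exact: is_linear_scal_l.
move=> x /is_filter_lim_locally_unique <- eps.
have c1 : 0 < Rabs c0 + 1 by have := Rabs_pos c0; lra.
have d0 : 0 < Rmin r (eps / (Rabs c0 + 1)).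
  by apply: Rmin_glb_lt => //; apply: Rdiv_lt_0_compat => //; apply: cond_pos.
exists (mkposreal _ d0) => y hy.
change (Cmod (y - s)%C < Rmin r (eps / (Rabs c0 + 1))) in hy.
change (Cmod (g y - g s - (y - s) * D)%C <= eps * Cmod (y - s)%C).
have h1 := Rlt_le_trans _ _ _ hy (Rmin_l _ _).
have h2 := Rlt_le_trans _ _ _ hy (Rmin_r _ _).
have := H (y - s)%C (Rlt_le _ _ h1).
rewrite (_ : s + (y - s) = y)%C; last by ring.
rewrite (Cmult_comm D) => h3; apply: Rle_trans h3 _.
rewrite /= Rmult_1_r -Rmult_assoc; apply: Rmult_le_compat_r; first exact: Cmod_ge_0.
apply: Rle_trans (_ : (Rabs c0 + 1) * Cmod (y - s)%C <= _).
  by apply: Rmult_le_compat_r; [exact: Cmod_ge_0|have := Rle_abs c0; lra].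
have -> : pos eps = (Rabs c0 + 1) * (eps / (Rabs c0 + 1)) by field; lra.
by apply: Rmult_le_compat_l; lra.
Qed.

Lemma Clim_csum (u : nat -> nat -> C) K :
  (forall k, exists a, Clim (fun N => u N k) a) ->
  exists l, Clim (fun N => \csum_(0 <= k < K) u N k) l.
Proof.
move=> H; elim: K => [|K [l Hl]].
  by exists (RtoC 0); apply: Clim_ext (Clim_const _) => N; rewrite big_geq.
have [a Ha] := H K; exists (l + a)%C.
by apply: Clim_ext (Clim_plus _ _ _ _ Hl Ha) => N; rewrite big_nat_recr.
Qed.

Lemma Clim_is_cauchy u l : Clim u l -> forall eps, 0 < eps ->
  exists N, forall m n, (N <= m)%N -> (N <= n)%N -> Cmod (u m - u n) <= eps.
Proof.
move=> /Clim_eps H eps e0; have e2 : 0 < eps / 2 by lra.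
have [N HN] := H _ e2; exists N => m n Nm Nn.
rewrite (_ : u m - u n = (u m - l) + - (u n - l))%C; last by ring.
apply: Rle_trans (Cmod_triangle _ _) _; rewrite Cmod_opp.
by have := HN m Nm; have := HN n Nn; lra.
Qed.

(** An [eps / 3] argument: [u] inherits the Cauchy property from convergent sequences that
    approximate it up to [eps] for all large [N]. Below, these are Taylor sums of fixed length and
    difference quotients. *)
Lemma Clim_cauchy_approx (u : nat -> C) :
  (forall eps, 0 < eps -> exists (v : nat -> C) l N0, Clim v l /\
    forall N, (N0 <= N)%N -> Cmod (u N - v N) <= eps) ->
  exists l, Clim u l.
Proof.
move=> H; apply: Clim_cauchy => eps e0; have e3 : 0 < eps / 3 by lra.
have [v [l [N0 [Hv HN0]]]] := H _ e3.
have [N1 HN1] := Clim_is_cauchy _ _ Hv _ e3.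
exists (maxn N0 N1) => m n; rewrite !geq_max => /andP[m0 m1] /andP[n0 n1].
rewrite (_ : u m - u n = (u m - v m) + ((v m - v n) + - (u n - v n)))%C; last by ring.
apply: Rle_trans (Cmod_triangle _ _) _.
have := Cmod_triangle (v m - v n) (- (u n - v n)); rewrite Cmod_opp.
by have := HN0 m m0; have := HN0 n n0; have := HN1 m n m1 n1; lra.
Qed.

Lemma Re_minus_le_Cmod a b : Re a - Cmod b <= Re (a + b)%C.
Proof.
have := re_le_Cmod b; have := Rle_abs (- Re b); rewrite Rabs_Ropp.
by case: a b => [a1 a2] [b1 b2] /=; lra.
Qed.

(* The disc around a point far to the right that almost reaches the boundary
   carries convergence of the Taylor coefficients over to pointwise
   convergence; the second-order Taylor bound, uniform in N, then passes to the
   limit. *)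
Lemma vitali (Q : nat -> C -> C) (A : nat -> C -> nat -> C) Delta B x0 :
  (forall N s rho, 0 <= rho -> expands (fun h => Q N (s + h)%C) (A N s) rho) ->
  (forall Delta', Delta < Delta' -> exists N0, forall N, (N0 <= N)%N ->
    forall s, Delta' <= Re s -> Cmod (Q N s) <= B) ->
  (forall s, x0 < Re s -> forall k, exists a, Clim (fun N => A N s k) a) ->
  exists g : C -> C, forall s, half_plane Delta s ->
    Clim (fun N => Q N s) (g s) /\ ex_derive g s.
Proof.
move=> HA HB Hlim.
have B0 : 0 <= B.
  have [N0 HN0] := HB (Delta + 1) (Rlt_plus_1 _).
  by apply: Rle_trans (Cmod_ge_0 _) (HN0 N0 (leqnn _) (RtoC (Delta + 1)) (Rle_refl _)).
(* The condition on [s] stands under the existential so that choice yields a total function [g]. *)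
have conv s : exists l, half_plane Delta s -> Clim (fun N => Q N s) l.
  case: (Rlt_dec Delta (Re s)) => [hs|hn]; last by exists (RtoC 0) => /hn.
  suff [l Hl] : exists l, Clim (fun N => Q N s) l by exists l.
  set x := Rmax x0 (Re s) + 1.
  have hx1 : x0 < x by have := Rmax_l x0 (Re s); rewrite /x; lra.
  have hx2 : Re s < x by have := Rmax_r x0 (Re s); rewrite /x; lra.
  pose s0 : C := (x, Im s); pose h : C := RtoC (Re s - x).
  have hE : Cmod h = x - Re s by rewrite Cmod_R Rabs_left1; lra.
  have sE : (s0 + h)%C = s.
    rewrite [RHS]surjective_pairing /s0 /h /Cplus /=.
    by congr pair; rewrite /Re /Im; ring.
  (* The disc about [s0] stops halfway between the line through [s] and the boundary [Re = Delta].
     It contains [s] in its interior, so [theta < 1], and stays where [Q N] is bounded. *)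
  pose rho := x - (Re s + Delta) / 2.
  have rho0 : 0 < rho by rewrite /rho; lra.
  have [N0 HN0] := HB ((Re s + Delta) / 2) ltac:(lra).
  pose theta := Cmod h / rho.
  have ht : 0 <= theta < 1.
    split; first by apply: Rdiv_le_0_compat => //; apply: Cmod_ge_0.
    apply: (Rmult_lt_reg_r rho) => //; rewrite /theta /Rdiv Rmult_assoc Rinv_l; last by lra.
    by rewrite hE /rho; lra.
  have est K N : (N0 <= N)%N ->
      Cmod (Q N s - \csum_(0 <= k < K) (A N s0 k * h ^ k)) <= B * theta ^ K / (1 - theta).
    move=> NN; rewrite -{1}sE.
    apply: (cauchy_remainder (fun h => Q N (s0 + h)%C) _ rho) => //.
    - lra.
    - by apply: HA; lra.
    - move=> h' hh'; apply: HN0 => //.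
      by have := Re_minus_le_Cmod s0 h'; rewrite {1}/s0 /= -/(Re s) => h1; rewrite /rho in hh'; lra.
    - by right; rewrite /theta; field; lra.
  apply: Clim_cauchy_approx => eps e0.
  have geo : is_lim_seq (fun K => B / (1 - theta) * theta ^ K) (B / (1 - theta) * 0).
    by apply: (is_lim_seq_scal_l _ _ 0); apply: is_lim_seq_geom; rewrite Rabs_pos_eq; lra.
  have /is_lim_seq_spec /(_ (mkposreal eps e0)) [K HK] := geo.
  have {HK} := HK K (le_n K); rewrite /= Rmult_0_r Rminus_0_r => HK.
  have {HK} := Rle_lt_trans _ _ _ (Rle_abs _) HK => HK.
  have [l Hl] := Clim_csum (fun N k => A N s0 k * h ^ k)%C K
    (fun k => match Hlim s0 hx1 k with
              | ex_intro a Ha => ex_intro _ (h ^ k * a)%C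
                 (Clim_ext _ _ _ (fun N => Cmult_comm _ _) (Clim_scal (h ^ k)%C _ _ Ha))
              end).
  exists (fun N => \csum_(0 <= k < K) (A N s0 k * h ^ k)), l, N0; split=> // N NN.
  apply: Rle_trans (est K N NN) _; left; apply: Rle_lt_trans HK; right.
  by field; lra.
have [g Hg] : exists g : C -> C, forall z,
    half_plane Delta z -> Clim (fun N => Q N z) (g z).
  exists (fun z => proj1_sig (constructive_indefinite_description _ (conv z))) => z.
  exact: (proj2_sig (constructive_indefinite_description _ (conv z))).
exists g => s hs; split; first exact: Hg.
rewrite /half_plane in hs.
pose rho := (Re s - Delta) / 2; have rho0 : 0 < rho by rewrite /rho; lra.
have inside h : Cmod h <= rho -> half_plane Delta (s + h)%C.
  by move=> hh; rewrite /half_plane; have := Re_minus_le_Cmod s h; rewrite /rho in hh; lra.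
have [N0 HN0] := HB ((Re s + Delta) / 2) ltac:(lra).
(* The remainder with [K = 2] is [B theta^2 / (1 - theta)] with [theta = |h| / rho]; for
   [|h| <= rho / 2] the denominator is at least [1 / 2]. *)
pose c0 := 2 * B / rho ^ 2.
have c00 : 0 <= c0 by apply: Rdiv_le_0_compat; [lra|apply: pow_lt].
have est N h : (N0 <= N)%N -> Cmod h <= rho / 2 ->
    Cmod (Q N (s + h)%C - Q N s - A N s 1%N * h)%C <= c0 * Cmod h ^ 2.
  move=> NN hh.
  have R K theta h' : 0 <= theta < 1 -> Cmod h' <= theta * rho ->
      Cmod (Q N (s + h')%C - \csum_(0 <= k < K) (A N s k * h' ^ k))
      <= B * theta ^ K / (1 - theta).
    move=> ht hh'; apply: (cauchy_remainder (fun h => Q N (s + h)%C) _ rho) => //; try lra.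
      by apply: HA; lra.
    move=> z hz; apply: HN0 => //.
    by have := Re_minus_le_Cmod s z; rewrite /rho in hz; lra.
  (* At [h = 0] with [K = 1] and [theta = 0] the remainder bound is 0. *)
  have A0 : A N s 0%N = Q N s.
    have := R 1%N 0 0 ltac:(lra); rewrite Cmod_0 Rmult_0_l => /(_ (Rle_refl _)).
    rewrite big_nat1 (_ : s + 0 = s)%C; last by ring.
    rewrite /= Cmult_1_r Rmult_0_l Rmult_0_r /Rdiv Rmult_0_l => h0.
    have h1 : (Q N s - A N s 0%N)%C = 0.
      by apply: Cmod_eq_0; apply: Rle_antisym => //; apply: Cmod_ge_0.
    by transitivity (Q N s - (Q N s - A N s 0%N))%C; [ring|rewrite h1; ring].
  set theta := Cmod h / rho.
  have t0 : 0 <= theta by apply: Rdiv_le_0_compat => //; apply: Cmod_ge_0.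
  have tE : theta * rho = Cmod h by rewrite /theta; field; lra.
  have t1 : theta <= 1 / 2.
    by apply: (Rmult_le_reg_r rho) => //; rewrite tE; lra.
  have := R 2%N theta h ltac:(lra) (Req_le _ _ (esym tE)).
  rewrite big_nat_recr //= big_nat1 A0 /= !Cmult_1_r.
  rewrite (_ : Q N (s + h) - (Q N s + A N s 1%N * h)
    = Q N (s + h) - Q N s - A N s 1%N * h)%C; last by ring.
  move=> h1; apply: Rle_trans h1 _; rewrite -tE /c0.
  have -> : 2 * B / (rho * (rho * 1)) * (theta * rho * (theta * rho * 1))
    = B * (theta * (theta * 1)) * 2 by field; lra.
  apply: Rmult_le_compat_l.
    by apply: Rmult_le_pos => //; apply: Rmult_le_pos => //; lra.
  rewrite -(Rinv_inv 2); apply: Rinv_le_contravar; lra.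
(* The first coefficient differs from the difference quotient with step [r] by at most [c0 * r],
   uniformly in large [N], and that quotient converges because [Q N] does at both points. *)
have [D HD] : exists D, Clim (fun N => A N s 1%N) D.
  apply: Clim_cauchy_approx => eps e0.
  set r := Rmin (rho / 2) (eps / (c0 + 1)).
  have r0 : 0 < r.
    by apply: Rmin_glb_lt; [lra|apply: Rdiv_lt_0_compat; lra].
  have hr : Cmod (RtoC r) = r by rewrite Cmod_R Rabs_pos_eq; lra.
  have r1 : r <= rho / 2 by apply: Rmin_l.
  have rn : RtoC r <> 0 by move=> /RtoC_inj; lra.
  exists (fun N => / RtoC r * (Q N (s + r)%C - Q N s))%C,
    (/ RtoC r * (g (s + r)%C - g s))%C, N0; split.
    apply: Clim_scal; apply: Clim_minus; apply: Hg => //.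
    by apply: inside; rewrite hr; lra.
  move=> N NN.
  have := est N (RtoC r) NN ltac:(lra); rewrite hr => h1.
  rewrite (_ : A N s 1%N - / r * (Q N (s + r) - Q N s)
    = - (/ r * (Q N (s + r) - Q N s - A N s 1%N * r)))%C; last by field.
  rewrite Cmod_opp Cmod_mult Cmod_inv // hr.
  apply: Rle_trans (_ : / r * (c0 * r ^ 2) <= _).
    by apply: Rmult_le_compat_l => //; left; apply: Rinv_0_lt_compat.
  have -> : / r * (c0 * r ^ 2) = c0 * r by field; lra.
  apply: Rle_trans (_ : (c0 + 1) * (eps / (c0 + 1)) <= _).
    by apply: Rmult_le_compat; [lra|lra|lra|apply: Rmin_r].
  by right; field; lra.
apply: (ex_derive_of_quadratic g s D c0 (rho / 2)); first by lra.
move=> h hh.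
have hh' : Cmod h <= rho by lra.
have L := Clim_minus _ _ _ _ (Clim_minus _ _ _ _ (Hg _ (inside h hh')) (Hg s hs))
  (Clim_scal h _ _ HD).
rewrite Cmult_comm; apply: (Clim_Cmod_le _ _ _ N0 L) => N NN.
by rewrite (Cmult_comm h); apply: est.
Qed.

(** * Taylor coefficients of Dirichlet polynomials *)

Definition Dmono_coef (n : nat) (s : C) (k : nat) : C :=
  (Dmono n s * RtoC ((- ln (INR n)) ^ k / INR (fact k)))%C.

Lemma expands_Dmono n s rho : 0 <= rho ->
  expands (fun h => Dmono n (s + h)) (Dmono_coef n s) rho.
Proof.
move=> r0; set L := Rabs (- ln (INR n)).
have L0 : 0 <= L by apply: Rabs_pos.
exists (fun m => Cmod (Dmono n s) * exp (L * rho) * ((L * rho) ^ m / INR (fact m))).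
split.
  rewrite -(Rmult_0_r (Cmod (Dmono n s) * exp (L * rho))).
  apply: (is_lim_seq_scal_l _ _ 0); apply/is_lim_seq_Reals.
  exact: cv_speed_pow_fact.
move=> m h hh; set z := (RtoC (- ln (INR n)) * h)%C.
have -> : \csum_(0 <= l < m) (Dmono_coef n s l * h ^ l)
    = (Dmono n s * exp_sum m z)%C.
  rewrite /exp_sum -csum_scal; apply: eq_bigr => l _.
  by rewrite /Dmono_coef /z Cpow_mult_l /Rdiv RtoC_mult RtoC_pow; ring.
rewrite Dmono_plus -/z (_ : Dmono n s * Cexp z - Dmono n s * exp_sum m z
  = Dmono n s * (Cexp z - exp_sum m z))%C; last by ring.
rewrite Cmod_mult Rmult_assoc; apply: Rmult_le_compat_l; first exact: Cmod_ge_0.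
apply: Rle_trans (Cexp_taylor m z) _; rewrite Rmult_comm.
have hz : Cmod z <= L * rho.
  by rewrite /z Cmod_mult Cmod_R; apply: Rmult_le_compat_l.
have f0 := INR_fact_lt_0 m.
apply: Rmult_le_compat.
- by left; apply: exp_pos.
- by apply: Rdiv_le_0_compat => //; apply: pow_le; apply: Cmod_ge_0.
- exact: exp_monotone.
- apply: Rmult_le_compat_r; first by left; apply: Rinv_0_lt_compat.
  by apply: pow_incr; split=> //; apply: Cmod_ge_0.
Qed.

Lemma expands_ext f g a b rho : (forall h, f h = g h) -> (forall k, a k = b k) ->
  expands f a rho -> expands g b rho.
Proof.
move=> E F [e [He H]]; exists e; split=> // m h hh.
rewrite -E -(eq_bigr _ (fun l _ => congr1 (fun x => x * h ^ l)%C (F l))).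
exact: H.
Qed.

Lemma expands_0 rho : expands (fun _ => RtoC 0) (fun _ => RtoC 0) rho.
Proof.
exists (fun _ => 0); split=> [|m h _]; first exact: is_lim_seq_const.
rewrite big1; first by rewrite /Cminus Cplus_opp_r Cmod_0; lra.
by move=> l _; ring.
Qed.

Lemma expands_add_scal f g a b c rho : expands f a rho -> expands g b rho ->
  expands (fun h => f h + c * g h)%C (fun k => a k + c * b k)%C rho.
Proof.
move=> [e [He H]] [e' [He' H']]; exists (fun m => e m + Cmod c * e' m); split.
  rewrite (_ : 0 = 0 + Cmod c * 0); last by ring.
  apply: is_lim_seq_plus' => //.
  exact: (is_lim_seq_scal_l _ (Cmod c) 0).
move=> m h hh.
have -> : \csum_(0 <= l < m) ((a l + c * b l) * h ^ l)
   = (\csum_(0 <= l < m) (a l * h ^ l) + c * (\csum_(0 <= l < m) (b l * h ^ l)))%C.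
  by rewrite -csum_scal -big_split; apply: eq_bigr => l _ /=; ring.
set S := \csum_(0 <= l < m) (a l * _); set T := \csum_(0 <= l < m) (b l * _).
rewrite (_ : f h + c * g h - (S + c * T) = (f h - S) + c * (g h - T))%C; last by ring.
apply: Rle_trans (Cmod_triangle _ _) _; apply: Rplus_le_compat; first exact: H.
by rewrite Cmod_mult; apply: Rmult_le_compat_l; [exact: Cmod_ge_0|exact: H'].
Qed.

Lemma expands_Dpoly X (a : nat -> C) s rho : 0 <= rho ->
  expands (fun h => \csum_(1 <= n < X.+1) (a n * Dmono n (s + h)))
    (fun k => \csum_(1 <= n < X.+1) (a n * Dmono_coef n s k)) rho.
Proof.
move=> r0; elim: X => [|X IH].
  by apply: expands_ext (expands_0 rho) => x; rewrite big_geq.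
apply: expands_ext (expands_add_scal _ _ _ _ (a X.+1) _ IH (expands_Dmono X.+1 s rho r0)).
  by move=> h; rewrite [in RHS]big_nat_recr.
by move=> k; rewrite [in RHS]big_nat_recr.
Qed.

Lemma pow_fact_le_exp x k : 0 <= x -> x ^ k / INR (fact k) <= exp x.
Proof.
move=> x0; apply: Rle_trans (exp_ge_taylor x k x0).
case: k => [|k]; first by rewrite /=; lra.
rewrite tech5; set S := sum_f_R0 _ _.
suff : 0 <= S by lra.
apply: cond_pos_sum => l; apply: Rdiv_le_0_compat; first exact: pow_le.
exact: INR_fact_lt_0.
Qed.

(** Since [(e ln n)^k / k! <= n^e], the logarithms produced by [k] differentiations cost only an
    arbitrarily small shift of the abscissa. *)
Lemma Cmod_Dmono_coef_le n s k e : (0 < n)%N -> 0 < e ->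
  Cmod (Dmono_coef n s k) <= / e ^ k * Rpower (INR n) (- (Re s - e)).
Proof.
move=> n0 e0; have l0 : 0 <= ln (INR n).
  case: n n0 => // n _; rewrite -ln_1; apply: ln_le; first by lra.
  by apply: (le_INR 1); apply/leP.
have ek := pow_lt e k e0.
rewrite /Dmono_coef Cmod_mult Cmod_Dmono Cmod_R Rabs_mult -RPow_abs Rabs_Ropp.
rewrite (Rabs_pos_eq _ l0) (Rabs_pos_eq (/ _)); last first.
  by left; apply: Rinv_0_lt_compat; apply: INR_fact_lt_0.
have -> : Rpower (INR n) (- (Re s - e)) = Rpower (INR n) (- Re s) * exp (e * ln (INR n)).
  by rewrite /Rpower -exp_plus; congr exp; ring.
have := pow_fact_le_exp (e * ln (INR n)) k (Rmult_le_pos _ _ (Rlt_le _ _ e0) l0).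
rewrite Rpow_mult_distr => h.
have h2 := Rmult_le_compat_l (/ e ^ k * Rpower (INR n) (- Re s)) _ _ _ h.
apply: Rle_trans (_ : / e ^ k * Rpower (INR n) (- Re s)
  * (e ^ k * ln (INR n) ^ k / INR (fact k)) <= _).
  by right; field; split; [exact: INR_fact_neq_0|lra].
rewrite -Rmult_assoc; apply: h2; apply: Rmult_le_pos; left; last exact: Rpower_gt0.
exact: Rinv_0_lt_compat.
Qed.
(** * The multiplier theorem *)
Lemma bounded_sums_plus u v :
  bounded_sums u -> bounded_sums v -> bounded_sums (fun n => u n + v n).
Proof.
move=> [u0 [B HB]] [v0 [K HK]]; split.
  by move=> n n0; apply: Rplus_le_le_0_compat; [apply: u0|apply: v0].
by exists (B + K) => N; rewrite big_split; apply: Rplus_le_compat.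
Qed.
(* AM-GM: 2 |c_n| n^{-x} <= |c_n|^2 w_n + n^{-2x} / w_n. *)
Lemma bounded_sums_coef w (P : nat -> bool) c x :
  (forall n, (0 < n)%N -> 0 < w n) -> wl2 w c ->
  bounded_sums (fun n => if P n then / w n * Rpower (INR n) (- 2 * x) else 0) ->
  bounded_sums (fun n => Cmod (if P n then c n else 0) * Rpower (INR n) (- x)).
Proof.
move=> hw Hc H.
have pos n : (0 < n)%N -> 0 <= Cmod (c n) ^ 2 * w n.
  by move=> n0; apply: Rmult_le_pos; [apply: pow2_ge_0|left; apply: hw].
apply: bounded_sums_le (bounded_sums_plus _ _ (summable_bounded_sums _ pos Hc) H).
move=> n n0; split.
  by apply: Rmult_le_pos; [exact: Cmod_ge_0|left; apply: Rpower_gt0].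
case: ifP => _; last by have := pos n n0; rewrite Cmod_0; lra.
have wn := hw n n0; have cn := Cmod_ge_0 (c n).
have -> : Rpower (INR n) (- 2 * x) = Rpower (INR n) (- x) ^ 2.
  by rewrite /Rpower /= Rmult_1_r -exp_plus; congr exp; ring.
have p0 := Rpower_gt0 (INR n) (- x); set p := Rpower _ _ in p0 *.
have i0 := Rinv_0_lt_compat _ wn.
have sq := pow2_ge_0 (Cmod (c n) * w n - p).
have E : Cmod (c n) ^ 2 * w n + / w n * p ^ 2 - 2 * (Cmod (c n) * p)
   = / w n * (Cmod (c n) * w n - p) ^ 2 by field; lra.
have := Rmult_le_pos _ _ (Rlt_le _ _ i0) sq.
have := Rmult_le_pos _ _ cn (Rlt_le _ _ p0).
by move: E; lra.
Qed.
Lemma is_lim_seq_inv_INR : is_lim_seq (fun n => / INR n.+1) 0.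
Proof.
apply: (is_lim_seq_inv _ p_infty) => //.
exact: (proj1 (is_lim_seq_incr_1 _ _) is_lim_seq_INR).
Qed.

(** * Consequences of the growth condition on the weights *)

Section WeightBounds.
Context (Delta : R) (w : nat -> R).
Context (hw : forall n : nat, (0 < n)%N -> 0 < w n).
Context (hC : forall sigma : R, Delta < sigma ->
    exists Csigma : R, 0 < Csigma /\
      forall n : nat, (0 < n)%N ->
        / w n * Rpower (INR n) (- 2 * sigma) <= Csigma).
Lemma bounded_sums_weight x : Delta + 1 / 2 < x ->
  bounded_sums (fun n => / w n * Rpower (INR n) (- 2 * x)).
Proof.
move=> hx; pose q := x - (Delta + 1 / 2).
have q0 : 0 < q by rewrite /q; lra.
have [K [K0 HK]] := hC (Delta + q / 2) ltac:(lra).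
apply: bounded_sums_le (bounded_sums_scal K _ (Rlt_le _ _ K0) (bounded_sums_Rpower q q0)).
move=> n n0; split.
  apply: Rmult_le_pos; left; last exact: Rpower_gt0.
  by apply: Rinv_0_lt_compat; apply: hw.
(* Half of the excess [q] is spent on the weight bound; what remains is the summable [n^(-1-q)]. *)
have -> : - 2 * x = - 2 * (Delta + q / 2) + - (1 + q) by rewrite /q; field.
rewrite Rpower_plus -Rmult_assoc; apply: Rmult_le_compat_r; last exact: HK.
by left; apply: Rpower_gt0.
Qed.
Lemma bounded_sums_kernel N x : Delta < x -> bounded_sums (kernel_term w N x).
Proof.
move=> hx; pose e := x - Delta; have e0 : 0 < e by rewrite /e; lra.
have [K [K0 HK]] := hC (Delta + e / 2) ltac:(lra).
apply: bounded_sums_le (bounded_sums_scal K _ (Rlt_le _ _ K0) (bounded_sums_smooth N e e0)).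
move=> n n0; split; first exact: kernel_term_ge0.
rewrite /kernel_term; case: ifP => _; last by lra.
(* On smooth numbers any positive exponent is summable, so the extra [1 / 2] in the abscissa
   disappears. *)
have -> : - 2 * x = - 2 * (Delta + e / 2) + - e by rewrite /e; field.
rewrite Rpower_plus -Rmult_assoc; apply: Rmult_le_compat_r; last exact: HK.
by left; apply: Rpower_gt0.
Qed.
Lemma restrict_smooth N u n :
  restrict (prime_span N) u n = if smooth N n then u n else 0.
Proof.
rewrite /restrict; case: excluded_middle_informative => [/smoothP ->|h] //.
by case: ifP => // /smoothP.
Qed.
(** On [Re s >= Delta + e] each [|n^{-s}|] is at most its value on the edge, where the smooth series
    converges absolutely. One cut [X] therefore leaves a tail of at most [e] on the whole
    half-plane. *)
Lemma Dirichlet_polynomial_approx phi c (M : R) N :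
  multiplier w (Delta + 1 / 2) phi -> wl2 w c ->
  (forall z, half_plane (Delta + 1 / 2) z -> is_Dsum c z (phi z)) ->
  Rbar_le (mult_norm w (Delta + 1 / 2) phi) M ->
  forall e, 0 < e -> exists X, (N <= X)%N /\
    forall s, Delta + e <= Re s ->
      Cmod (\csum_(1 <= n < X.+1) (smooth_part N c n * Dmono n s)) <= M + e.
Proof.
move=> hphi Hw Hc HM e e0.
have S := bounded_sums_coef _ _ _ _ hw Hw (bounded_sums_kernel N (Delta + e) ltac:(lra)).
have [X0 HX0] := bounded_sums_tail _ S _ e0.
exists (maxn N X0); split; first exact: leq_maxl.
move=> s hs; set X := maxn N X0.
have dom n : (0 < n)%N -> Cmod (smooth_part N c n * Dmono n s)
    <= Cmod (if smooth N n then c n else 0) * Rpower (INR n) (- (Delta + e)).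
  move=> n0; rewrite Cmod_mult Cmod_Dmono; apply: Rmult_le_compat_l.
    exact: Cmod_ge_0.
  by apply: Rpower_le_exponent => //; lra.
have [l Hl] := abs_conv (fun n => smooth_part N c n * Dmono n s)%C
  (bounded_sums_le _ _ (fun n n0 => conj (Cmod_ge_0 _) (dom n n0)) S).
have lM : Cmod l <= M.
  apply: (smooth_part_bound w (Delta + 1 / 2) phi c N s) => //.
    by apply: bounded_sums_kernel; lra.
  exact/is_Dsum_Clim.
have := csum_Clim_tail _ _ X e Hl.
set T := \csum_(1 <= n < X.+1) _ => h.
have {}h : Cmod (l - T) <= e.
  apply: h => y; apply: Rle_trans (HX0 X.+1 y _); last by rewrite ltnS leq_maxr.
  by apply: rsum_le => i /andP[Xi _]; apply: dom; apply: leq_trans Xi.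
rewrite (_ : T = l + - (l - T))%C; last by ring.
apply: Rle_trans (Cmod_triangle _ _) _; rewrite Cmod_opp; lra.
Qed.
Lemma multiplier_continuation phi (M : R) :
  multiplier w (Delta + 1 / 2) phi ->
  Rbar_le (mult_norm w (Delta + 1 / 2) phi) M ->
  exists g, is_continuation phi (Delta + 1 / 2) Delta g /\
    forall s, half_plane Delta s -> Cmod (g s) <= M.
Proof.
move=> hphi HM.
pose one n := if n == 1%N then RtoC 1 else RtoC 0.
(* The constant 1 belongs to the space, so [phi = phi * 1] has a Dirichlet series. *)
have [c [Hw Hc]] : in_Hw w (Delta + 1 / 2) (fun s => phi s * RtoC 1)%C.
  apply: (hphi (fun _ => RtoC 1)); exists one.
  have fin n : (1 < n)%N -> one n = RtoC 0 by case: n => [|[|n]].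
  split=> [|s _]; first exact: wl2_finite fin.
  by have := is_Dsum_finite 1 one s fin; rewrite big_nat1 Dmono_1 Cmult_1_r.
have {}Hc z : half_plane (Delta + 1 / 2) z -> is_Dsum c z (phi z).
  by move=> /Hc; rewrite Cmult_1_r.
pose eps N := / INR N.+1.
have eps0 N : 0 < eps N by apply: Rinv_0_lt_compat; apply: INR_gt0.
have approx N := Dirichlet_polynomial_approx phi c M N hphi Hw Hc HM (eps N) (eps0 N).
have [X HX] : exists X : nat -> nat, forall N, (N <= X N)%N /\ forall s,
    Delta + eps N <= Re s ->
    Cmod (\csum_(1 <= n < (X N).+1) (smooth_part N c n * Dmono n s)) <= M + eps N.
  exists (fun N => proj1_sig (constructive_indefinite_description _ (approx N))) => N.
  exact: (proj2_sig (constructive_indefinite_description _ (approx N))).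
pose Q N s := \csum_(1 <= n < (X N).+1) (smooth_part N c n * Dmono n s).
pose A N s k := \csum_(1 <= n < (X N).+1) (smooth_part N c n * Dmono_coef n s k).
(* Stated for general [t] to cover both the values, [t n = n^{-s}], and the Taylor coefficients,
   [t n = Dmono_coef n s k]. *)
have lim (t : nat -> C) (K y : R) l : 0 <= K -> Delta + 1 / 2 < y ->
    (forall n, (0 < n)%N -> Cmod (t n) <= K * Rpower (INR n) (- y)) ->
    Clim (fun N => \csum_(1 <= n < N.+1) (c n * t n)) l ->
    Clim (fun N => \csum_(1 <= n < (X N).+1) (smooth_part N c n * t n)) l.
  move=> K0 hy Ht Hl.
  have S := bounded_sums_coef w xpredT c y hw Hw (bounded_sums_weight y hy).
  apply: (tannery _ (fun n => c n * t n)%C _ X l (bounded_sums_scal K _ K0 S)) => //.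
  - move=> N n n0; rewrite Cmod_mult /smooth_part /=.
    have h : Cmod (if smooth N n then c n else 0) <= Cmod (c n).
      by case: ifP => _; [lra|rewrite Cmod_0; apply: Cmod_ge_0].
    have := Rmult_le_compat _ _ _ _ (Cmod_ge_0 _) (Cmod_ge_0 (t n)) h (Ht n n0); lra.
  - move=> n n0; rewrite Cmod_mult /=.
    have := Rmult_le_compat_l _ _ _ (Cmod_ge_0 (c n)) (Ht n n0); lra.
  - move=> n n0; exists n => N nN.
    by rewrite /smooth_part smooth_eventually.
  - by move=> N; case: (HX N).
have Qlim s : half_plane (Delta + 1 / 2) s -> Clim (fun N => Q N s) (phi s).
  move=> hs; apply: (lim _ 1 (Re s)) => //; first by lra.
    by move=> n _; rewrite Cmod_Dmono; lra.
  by apply/is_Dsum_Clim; apply: Hc.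
have epsle N0 N : (N0 <= N)%N -> eps N <= eps N0.
  move=> NN; apply: Rinv_le_contravar; first exact: INR_gt0.
  by apply: le_INR; apply/leP.
have epslim Delta' : Delta < Delta' ->
    exists N0, forall N, (N0 <= N)%N -> Delta + eps N <= Delta'.
  move=> h; have d0 : 0 < Delta' - Delta by lra.
  have /is_lim_seq_spec /(_ (mkposreal _ d0)) [N0 HN0] := is_lim_seq_inv_INR.
  exists N0 => N NN; have := HN0 N0 (le_n _); rewrite /= Rminus_0_r => h1.
  have := Rle_lt_trans _ _ _ (Rle_abs _) h1; have := epsle _ _ NN.
  by rewrite /eps /=; lra.
have HB Delta' : Delta < Delta' -> exists N0, forall N, (N0 <= N)%N ->
    forall s, Delta' <= Re s -> Cmod (Q N s) <= M + 1.
  move=> /epslim [N0 HN0]; exists N0 => N NN s hs.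
  case: (HX N) => _ /(_ s) h; apply: Rle_trans (h _) _.
    by have := HN0 N NN; lra.
  by have := epsle 0%N N (leq0n N); rewrite /eps /= Rinv_1; lra.
have Hlim s : Delta + 1 / 2 < Re s -> forall k, exists a, Clim (fun N => A N s k) a.
  move=> hs k; pose e := (Re s - (Delta + 1 / 2)) / 2.
  have e0 : 0 < e by rewrite /e; lra.
  have ek : 0 <= / e ^ k by left; apply: Rinv_0_lt_compat; apply: pow_lt.
  have hy : Delta + 1 / 2 < Re s - e by rewrite /e; lra.
  have S := bounded_sums_scal _ _ ek
    (bounded_sums_coef w xpredT c (Re s - e) hw Hw (bounded_sums_weight _ hy)).
  have [l Hl] : exists l,
      Clim (fun N => \csum_(1 <= n < N.+1) (c n * Dmono_coef n s k)) l.
    apply: abs_conv; apply: bounded_sums_le S => n n0.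
    split; first exact: Cmod_ge_0.
    rewrite Cmod_mult /=.
    have := Rmult_le_compat_l _ _ _ (Cmod_ge_0 (c n)) (Cmod_Dmono_coef_le n s k e n0 e0).
    lra.
  exists l; apply: (lim _ (/ e ^ k) (Re s - e)) => // n n0.
  exact: Cmod_Dmono_coef_le.
have [g Hg] := vitali Q A Delta (M + 1) (Delta + 1 / 2)
  (fun N s rho r0 => expands_Dpoly (X N) (smooth_part N c) s rho r0) HB Hlim.
exists g; split; first split.
- by move=> s /Hg [].
- move=> s hs; have hs' : half_plane Delta s by move: hs; rewrite /half_plane; lra.
  by apply: Clim_unique (Qlim s hs); case: (Hg s hs').
(* The normal-family step used only the crude bound [M + 1]; pointwise, [M + eps N] with [eps N]
   tending to 0 restores the constant [M]. *)
- move=> s hs; case: (Hg s hs) => /Clim_Cmod L _.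
  have [N0 HN0] := epslim _ hs.
  apply: (is_lim_seq_le_loc (fun N => Cmod (Q N s)) (fun N => M + eps N) (Cmod (g s)) M _ L).
    by exists N0 => N /leP NN; case: (HX N) => _; apply; apply: HN0.
  rewrite -{2}(Rplus_0_r M); apply: is_lim_seq_plus' is_lim_seq_inv_INR.
  exact: is_lim_seq_const.
Qed.

End WeightBounds.

(** The zero function and its image put a real number into the set whose supremum is taken. *)
Lemma mult_norm_not_m_infty w sigma0 phi :
  multiplier w sigma0 phi -> mult_norm w sigma0 phi <> m_infty.
Proof.
move=> hphi E.
have Z : Hw_repr w sigma0 (fun _ => RtoC 0) (fun _ => RtoC 0).
  split=> [|s _]; first exact: (wl2_finite w 0).
  have := is_Dsum_finite 0 (fun _ => RtoC 0) s (fun _ _ => erefl).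
  by rewrite big_geq.
have [b Hb] := hphi (fun _ => RtoC 0)
  (ex_intro (fun a => Hw_repr w sigma0 a _) (fun _ => RtoC 0) Z).
have : Rbar_le (wnorm w b) (mult_norm w sigma0 phi); last by rewrite E.
apply: (proj1 (Lub_Rbar_correct _)).
exists (fun _ => RtoC 0), (fun _ => RtoC 0), b; split=> //; split=> //.
by rewrite (wnorm_finite w 0) // big_geq // sqrt_0; lra.
Qed.

Theorem theorem3p5 (Delta : R) (hDelta : 0 <= Delta)
  (w : nat -> R) (hw : forall n : nat, (0 < n)%N -> 0 < w n)
  (hC : forall sigma : R, Delta < sigma ->
    exists Csigma : R, 0 < Csigma /\
      forall n : nat, (0 < n)%N ->
        / w n * Rpower (INR n) (- 2 * sigma) <= Csigma)
  (phi : C -> C) (hphi : multiplier w (Delta + 1 / 2) phi) :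
  (forall sigma' : R, Delta + 1 / 2 < sigma' ->
    summable (fun n => / w n * Rpower (INR n) (- 2 * sigma'))) /\
  (forall N : nat, (0 < N)%N -> forall sigma : R, Delta < sigma ->
    summable (restrict (prime_span N)
      (fun n => / w n * Rpower (INR n) (- 2 * sigma)))) /\
  Rbar_le (sup_norm phi (Delta + 1 / 2) Delta)
          (mult_norm w (Delta + 1 / 2) phi).
Proof.
split; [|split].
- by move=> x hx; apply: bounded_sums_summable; apply: (bounded_sums_weight Delta).
- move=> N _ x hx.
  have := bounded_sums_summable _ (bounded_sums_kernel Delta w hw hC N x hx).
  by apply: ex_series_ext => k; rewrite restrict_smooth.
(* A finite norm is the substantial case: the continuation [g] shows that [M] belongs to the set
   whose infimum is [sup_norm]. *)
- case E : (mult_norm _ _ _) => [M||].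
  + have HM : Rbar_le (mult_norm w (Delta + 1 / 2) phi) M.
      by rewrite E; apply: Rbar_le_refl.
    have [g Hg] := multiplier_continuation Delta w hw hC phi M hphi HM.
    by apply: (proj1 (Glb_Rbar_correct _)); exists g.
  + by case: (sup_norm _ _ _).
  + by case: (mult_norm_not_m_infty _ _ _ hphi E).
Qed.
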